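(* Let $\omega=\pi/2$. There exists an adaptive probing strategy which, for every $n$ and every convex polygon $\mathcal{O}$ with $n$ vertices all of whose internal angles are strictly larger than $\pi/2$, determines $\mathcal{O}$ exactly (all its vertices) using at most $2n-3$ $\omega$-probes.
   Context: An $\omega$-wedge $\mathcal{W}(\omega,q,H_1,H_2)$ is the closed region formed by a point $q$ (the apex), two rays $H_1,H_2$ emanating from $q$ with angle $\omega$ between them such that $H_2$ is obtained from $H_1$ by a counterclockwise rotation by $\omega$, and all points between them. A valid $\omega$-probe of a convex polygon $\mathcal{O}$ with respect to a directed line $\overrightarrow{L}$ is an $\omega$-wedge containing $\mathcal{O}$, each of whose rays contains at least one point of $\mathcal{O}$, whose apex $q$ lies on $\overrightarrow{L}$, and such that the ray from $q$ in the direction of $\overrightarrow{L}$ intersects $\mathcal{O}$. Probing model: $\mathcal{O}$ is unknown to the prober, who knows only a point $p\in\mathcal{O}$ and a circle $\Psi$ with $\mathcal{O}$ contained in the disk bounded by $\Psi$ (the number $n$ of vertices is not known). One $\omega$-probe consists of the prober choosing a directed line $\overrightarrow{L}$; if a valid $\omega$-probe of $\mathcal{O}$ with respect to $\overrightarrow{L}$ exists, the prober receives its apex $q$, its rays $H_1,H_2$, and the points $p_1\in\mathcal{O}\cap H_1$, $p_2\in\mathcal{O}\cap H_2$ closest to $q$; otherwise the prober is told only that the probe missed $\mathcal{O}$. A strategy is adaptive: each chosen line may depend on all previous outcomes. *)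

(* Defs.v *)
From Stdlib Require Import Reals Lra List.
Open Scope R_scope.

Definition point := (R * R)%type.

Definition vadd (a b : point) : point := (fst a + fst b, snd a + snd b).
Definition vsub (a b : point) : point := (fst a - fst b, snd a - snd b).
Definition vscale (s : R) (a : point) : point := (s * fst a, s * snd a).
Definition dot (a b : point) : R := fst a * fst b + snd a * snd b.
Definition cross (a b : point) : R := fst a * snd b - snd a * fst b.
Definition vnorm (a : point) : R := sqrt (dot a a).
Definition pdist (a b : point) : R := vnorm (vsub a b).
Definition origin : point := (0, 0).

Definition rot (w : R) (u : point) : point :=
  (cos w * fst u - sin w * snd u, sin w * fst u + cos w * snd u).

Definition angle (a b : point) : R := acos (dot a b / (vnorm a * vnorm b)).

Definition region := point -> Prop.

(** ** Convex polygons.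
    A convex polygon with n vertices is given by the list [vs] of its vertices
    in counterclockwise order; vertex i is [vtx vs i] (indices mod n).  The list
    is in strictly convex position: every other vertex lies strictly to the left
    of each directed edge v_i v_(i+1).  The polygon (closed region) is the
    intersection of the closed left half-planes of its edges, i.e. the convex
    hull of its vertices. *)
Definition vtx (vs : list point) (i : nat) : point :=
  nth (Nat.modulo i (length vs)) vs origin.

Definition convex_polygon_vertices (n : nat) (vs : list point) : Prop :=
  (3 <= n)%nat /\ length vs = n /\
  forall i j : nat, (i < n)%nat -> (j < n)%nat -> j <> i -> j <> S i mod n ->
    cross (vsub (vtx vs (S i)) (vtx vs i)) (vsub (vtx vs j) (vtx vs i)) > 0.

Definition polygon_region (vs : list point) : region :=
  fun x => forall i : nat, (i < length vs)%nat ->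
    cross (vsub (vtx vs (S i)) (vtx vs i)) (vsub x (vtx vs i)) >= 0.

Definition internal_angle (vs : list point) (i : nat) : R :=
  let n := length vs in
  angle (vsub (vtx vs (i + n - 1)) (vtx vs i)) (vsub (vtx vs (S i)) (vtx vs i)).

Definition on_ray (q u x : point) : Prop :=
  exists s, 0 <= s /\ x = vadd q (vscale s u).

Definition in_wedge (w : R) (q u x : point) : Prop :=
  exists s t, 0 <= s /\ 0 <= t /\ x = vadd q (vadd (vscale s u) (vscale t (rot w u))).

(** A directed line: a point on it and a (nonzero) direction. *)
Definition line := (point * point)%type.
Definition proper_line (L : line) : Prop := snd L <> origin.
Definition on_line (L : line) (x : point) : Prop :=
  exists t, x = vadd (fst L) (vscale t (snd L)).

Definition valid_probe (w : R) (O : region) (L : line) (q u : point) : Prop :=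
  u <> origin /\
  on_line L q /\
  (forall x, O x -> in_wedge w q u x) /\
  (exists x, O x /\ on_ray q u x) /\
  (exists x, O x /\ on_ray q (rot w u) x) /\
  (exists x, O x /\ on_ray q (snd L) x).

Definition closest_on_ray (O : region) (q u p : point) : Prop :=
  O p /\ on_ray q u p /\
  forall y, O y -> on_ray q u y -> pdist q p <= pdist q y.

(** Outcome of one probe. [Hit q u p1 p2]: apex q, rays H1 = ray(q,u) and
    H2 = ray(q, rot w u), and the closest contact points p1, p2. *)
Inductive response :=
  | Miss : response
  | Hit : point -> point -> point -> point -> response.

(** The responses the prober may receive (if several valid probes exist, any
    of them may be returned: the strategy must work for all). *)
Definition valid_response (w : R) (O : region) (L : line) (r : response) : Prop :=
  match r with
  | Miss => ~ (exists q u, valid_probe w O L q u)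
  | Hit q u p1 p2 =>
      valid_probe w O L q u /\ closest_on_ray O q u p1 /\
      closest_on_ray O q (rot w u) p2
  end.

Inductive action :=
  | Probe : line -> action
  | Answer : list point -> action.

Definition history := list (line * response).

(** A strategy knows a point p of O and a circle (center c, radius rho)
    enclosing O, and decides the next action from the history so far. *)
Definition strategy := point -> point -> R -> history -> action.

Fixpoint succeeds (w : R) (Og : region) (vs : list point)
  (strat : history -> action) (k : nat) (h : history) : Prop :=
  match strat h with
  | Answer A => forall x, In x A <-> In x vs
  | Probe L =>
      match k with
      | 0%nat => False
      | S k' => proper_line L /\
          forall r, valid_response w Og L r -> succeeds w Og vs strat k' (h ++ (L, r) :: nil)
      end
  end.

(* Main.v *)
Require Import Defs.
From Stdlib Require Import Reals List.
From Stdlib Require Import Lra Psatz Lia Arith.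
From Stdlib Require Import ClassicalEpsilon FunctionalExtensionality.
Import ListNotations.
Open Scope R_scope.

(** Count the vertices seen and the edges confirmed; the total must reach 2n.  Given two known
    vertices w, b consecutive in counterclockwise order among the known ones, a probe along the
    line from b to w either is flush with w b, and confirms this edge, or has its second contact
    strictly beyond w b, at a new vertex.  So every probe gains at least one, and three more must
    be won.  The first probe gains two (contacts p1 and p2).  The second, along p1 p2, gains
    one on each side of the line: its first contact x is new, its second contact is new or
    confirms p2 p1.  Then one insists on the edge ending at x until it is confirmed.  At that
    moment the first ray is orthogonal to this edge and touches the polygon at a vertex that
    cannot be among the earlier ones: normal cones at obtuse vertices are smaller than a right
    angle, so two orthogonal directions never support the same vertex.  That vertex is new now,
    or it was the first contact of a previous probe whose second contact was also new. *)

(** * Supporting directions of an obtuse polygon *)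

Definition perp (u : point) : point := (- snd u, fst u).

Ltac unvec := unfold perp, dot, cross, vsub, vadd, vscale in *; cbn [fst snd] in *.

Lemma rot_half_pi u : rot (PI / 2) u = perp u.
Proof. unfold rot, perp. rewrite cos_PI2, sin_PI2. f_equal; ring. Qed.

Lemma point_eq (a b : point) : fst a = fst b -> snd a = snd b -> a = b.
Proof. destruct a, b; cbn; congruence. Qed.

Lemma dot_self_pos u : u <> origin -> 0 < dot u u.
Proof.
  intros H. destruct u as [a b]; unvec.
  destruct (Req_dec a 0) as [->|Ha]; [destruct (Req_dec b 0) as [->|Hb]|].
  - now destruct H.
  - nra.
  - nra.
Qed.

Lemma vsub_neq a b : a <> b -> vsub a b <> origin.
Proof.
  intros H E. apply H. unfold vsub, origin in E. injection E; intros.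
  apply point_eq; lra.
Qed.

Lemma perp_neq u : u <> origin -> perp u <> origin.
Proof.
  intros H E. apply H. destruct u as [a b]. unfold perp, origin in *; cbn in E.
  injection E; intros; f_equal; lra.
Qed.

Lemma dot_cross_eq u x y : u <> origin ->
  dot u x = dot u y -> cross u x = cross u y -> x = y.
Proof.
  intros Hu Hd Hc. pose proof (dot_self_pos u Hu) as P.
  assert (H1 : dot u u * (fst x - fst y) = 0).
  { replace (dot u u * (fst x - fst y)) with
      (fst u * (dot u x - dot u y) - snd u * (cross u x - cross u y))
      by (unvec; ring). rewrite Hd, Hc; ring. }
  assert (H2 : dot u u * (snd x - snd y) = 0).
  { replace (dot u u * (snd x - snd y)) with
      (snd u * (dot u x - dot u y) + fst u * (cross u x - cross u y))
      by (unvec; ring). rewrite Hd, Hc; ring. }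
  apply point_eq; nra.
Qed.

Lemma dot_cross_sub_eq u x y : u <> origin ->
  dot u (vsub x y) = 0 -> cross u (vsub x y) = 0 -> x = y.
Proof.
  intros Hu Hd Hc. apply (dot_cross_eq u); auto; unvec; lra.
Qed.

(** Cramer's rule: the coordinates of [t] in the basis [e], [f] are quotients of these cross
    products by [cross e f]. *)
Lemma independent_cross e f t :
  0 < cross e f -> cross e t = 0 -> cross f t = 0 -> t = origin.
Proof.
  intros P Z1 Z2.
  assert (A1 : cross e f * fst t = fst f * cross e t - fst e * cross f t) by (unvec; ring).
  assert (A2 : cross e f * snd t = snd f * cross e t - snd e * cross f t) by (unvec; ring).
  rewrite Z1, Z2 in A1, A2.
  apply point_eq; change (fst origin) with 0; change (snd origin) with 0;
    apply (Rmult_eq_reg_l (cross e f)); lra.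
Qed.

Lemma independent_dot e f k :
  0 < cross e f -> dot k e = 0 -> dot k f = 0 -> k = origin.
Proof.
  intros P Z1 Z2. pose proof (independent_cross e f (perp k) P) as H.
  assert (E : perp k = origin) by (apply H; unvec; lra).
  unfold perp, origin in E. injection E; intros.
  apply point_eq; cbn; lra.
Qed.

(** * Cyclic indices, convex position and turning at a vertex *)

Lemma polygon_vertex_index vs v : In v vs -> exists i, (i < length vs)%nat /\ v = vtx vs i.
Proof.
  intros H. destruct (In_nth vs v origin H) as [i [Hi E]].
  exists i. split; auto. unfold vtx. rewrite Nat.mod_small; auto.
Qed.

Lemma vtx_In vs i : (0 < length vs)%nat -> In (vtx vs i) vs.
Proof. intros H. apply nth_In, Nat.mod_upper_bound. lia. Qed.

Lemma vtx_mod vs i : vtx vs (i mod length vs) = vtx vs i.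
Proof. unfold vtx. now rewrite Nat.Div0.mod_mod. Qed.

Lemma vtx_S_mod vs i : vtx vs (S (i mod length vs)) = vtx vs (S i).
Proof.
  unfold vtx. f_equal. rewrite <- (Nat.add_1_r (i mod _)), <- (Nat.add_1_r i).
  now rewrite Nat.Div0.add_mod_idemp_l.
Qed.

Lemma vtx_period vs i : vtx vs (i + length vs) = vtx vs i.
Proof.
  unfold vtx. replace (i + length vs)%nat with (i + 1 * length vs)%nat by lia.
  now rewrite Nat.Div0.mod_add.
Qed.

Definition edge (vs : list point) (i : nat) : point := vsub (vtx vs (S i)) (vtx vs i).

Lemma strictly_left n vs i v : convex_polygon_vertices n vs -> In v vs ->
  v = vtx vs i \/ v = vtx vs (S i) \/ 0 < cross (edge vs i) (vsub v (vtx vs i)).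
Proof.
  intros (Hn & Hl & H) Hv. destruct (polygon_vertex_index _ _ Hv) as [j [Hj ->]].
  destruct (Nat.eq_dec j (i mod n)) as [E|E].
  { left. rewrite E, <- Hl. apply vtx_mod. }
  destruct (Nat.eq_dec j (S (i mod n) mod n)) as [E'|E'].
  { right; left. rewrite E', <- Hl. rewrite vtx_mod. apply vtx_S_mod. }
  right; right. unfold edge. rewrite <- (vtx_mod vs i), <- (vtx_S_mod vs i), Hl.
  apply H; auto; try lia. apply Nat.mod_upper_bound; lia.
Qed.

Lemma weakly_left n vs i v : convex_polygon_vertices n vs -> In v vs ->
  0 <= cross (edge vs i) (vsub v (vtx vs i)).
Proof.
  intros C Hv. destruct (strictly_left n vs i v C Hv) as [->|[->|H]]; try lra;
  unfold edge; unvec; lra.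
Qed.

Lemma region_left n vs i x : convex_polygon_vertices n vs -> polygon_region vs x ->
  0 <= cross (edge vs i) (vsub x (vtx vs i)).
Proof.
  intros (Hn & Hl & _) Hx. unfold edge. rewrite <- (vtx_mod vs i), <- (vtx_S_mod vs i).
  apply Rge_le, Hx, Nat.mod_upper_bound; lia.
Qed.

Lemma vertex_in_region n vs v : convex_polygon_vertices n vs -> In v vs ->
  polygon_region vs v.
Proof. intros C Hv i Hi. apply Rle_ge, (weakly_left n); auto. Qed.

Lemma edge_turn_left n vs i : convex_polygon_vertices n vs ->
  0 < cross (edge vs i) (edge vs (S i)).
Proof.
  intros C. pose proof C as (Hn & Hl & H). set (r := (i mod n)%nat).
  assert (Hr : (r < n)%nat) by (apply Nat.mod_upper_bound; lia).
  (* Because [3 <= n], the residues of [r], [S r] and [S (S r)] are pairwise distinct even when they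
     wrap around, so convexity applies to the vertex after next. *)
  assert (P : forall j, (j < n)%nat -> j = S r mod n \/ j = S (S r) mod n ->
     (j <> r)).
  { intros j Hj [->| ->] E.
    - destruct (Nat.lt_ge_cases (S r) n) as [L|L].
      + rewrite Nat.mod_small in E; lia.
      + replace (S r) with n in E by lia. rewrite Nat.Div0.mod_same in E. lia.
    - destruct (Nat.lt_ge_cases (S (S r)) n) as [L|L].
      + rewrite Nat.mod_small in E; lia.
      + replace (S (S r)) with ((S (S r) - n) + 1 * n)%nat in E by lia.
        rewrite Nat.Div0.mod_add, Nat.mod_small in E; lia. }
  assert (Q : (S (S r) mod n <> S r mod n)%nat).
  { intros E. destruct (Nat.lt_ge_cases (S r) n) as [L|L].
    - rewrite (Nat.mod_small (S r)) in E; auto.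
      destruct (Nat.lt_ge_cases (S (S r)) n) as [L'|L'].
      + rewrite Nat.mod_small in E; lia.
      + replace (S (S r)) with n in E by lia. rewrite Nat.Div0.mod_same in E. lia.
    - replace (S r) with n in E by lia. rewrite Nat.Div0.mod_same in E.
      replace (S n) with (1 + 1 * n)%nat in E by lia.
      rewrite Nat.Div0.mod_add, Nat.mod_small in E; lia. }
  pose proof (H r (S (S r) mod n)%nat Hr) as G.
  assert (G' : cross (edge vs i) (vsub (vtx vs (S (S i))) (vtx vs i)) > 0).
  { unfold edge. rewrite <- (vtx_mod vs i), <- (vtx_S_mod vs i), Hl.
    fold r. replace (vtx vs (S (S i))) with (vtx vs (S (S r) mod n)%nat).
    - apply G; auto; try (apply Nat.mod_upper_bound; lia).
      apply P; auto. apply Nat.mod_upper_bound; lia.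
    - unfold r. rewrite <- Hl, vtx_mod.
      rewrite <- (vtx_S_mod vs (S i)), <- (vtx_S_mod vs (S (i mod _))).
      f_equal. f_equal.
      rewrite <- (Nat.add_1_r (i mod _)), <- (Nat.add_1_r i).
      now rewrite Nat.Div0.add_mod_idemp_l. }
  unfold edge in *. unvec. lra.
Qed.

Lemma acos_nonneg_le t : 0 <= t -> acos t <= PI / 2.
Proof.
  intros [H|<-]; [|rewrite acos_0; lra].
  rewrite acos_atan by assumption. apply Rlt_le, atan_bound.
Qed.

Definition obtuse (vs : list point) : Prop :=
  forall i, (i < length vs)%nat -> internal_angle vs i > PI / 2.

(** An internal angle above a right angle means that the direction turns by less than a right angle
    from one edge to the next. *)
Lemma edge_dot_pos n vs i : convex_polygon_vertices n vs -> obtuse vs ->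
  0 < dot (edge vs i) (edge vs (S i)).
Proof.
  intros (Hn & Hl & _) H. set (r := (S i mod n)%nat).
  assert (Hr : (r < length vs)%nat) by (rewrite Hl; apply Nat.mod_upper_bound; lia).
  specialize (H r Hr). unfold internal_angle, angle in H.
  assert (E1 : vtx vs (r + length vs - 1) = vtx vs i).
  { unfold r. rewrite <- Hl.
    replace (S i mod length vs + length vs - 1)%nat
      with (S i mod length vs + (length vs - 1))%nat by lia.
    unfold vtx. rewrite Nat.Div0.add_mod_idemp_l.
    replace (S i + (length vs - 1))%nat with (i + 1 * length vs)%nat by lia.
    now rewrite Nat.Div0.mod_add. }
  assert (E2 : vtx vs r = vtx vs (S i)) by (unfold r; rewrite <- Hl; apply vtx_mod).
  assert (E3 : vtx vs (S r) = vtx vs (S (S i))) by (unfold r; rewrite <- Hl; apply vtx_S_mod).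
  rewrite E1, E2, E3 in H.
  set (a := vsub (vtx vs i) (vtx vs (S i))) in *.
  set (b := vsub (vtx vs (S (S i))) (vtx vs (S i))) in *.
  assert (D : dot a b < 0).
  { destruct (Rle_lt_dec 0 (dot a b)) as [L|L]; auto. exfalso.
    apply (Rlt_not_le _ _ H), acos_nonneg_le.
    unfold vnorm, Rdiv. apply Rmult_le_pos; auto.
    (* Division by zero yields 0, so the quotient is nonnegative in this case as well. *)
    destruct (Req_dec (sqrt (dot a a) * sqrt (dot b b)) 0) as [->|N].
    - rewrite Rinv_0; lra.
    - left. apply Rinv_0_lt_compat.
      pose proof (sqrt_pos (dot a a)); pose proof (sqrt_pos (dot b b)). nra. }
  unfold edge. subst a b. unvec. lra.
Qed.

(* Every vertex is written [vtx vs (S i)], so that both its edges have a natural-number index. *)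
Lemma vertex_succ n vs v : convex_polygon_vertices n vs -> In v vs ->
  exists i, v = vtx vs (S i).
Proof.
  intros (Hn & Hl & _) Hv. destruct (polygon_vertex_index _ _ Hv) as [i [Hi ->]].
  exists (i + length vs - 1)%nat.
  replace (S (i + length vs - 1)) with (i + length vs)%nat by lia.
  now rewrite vtx_period.
Qed.

(** Cramer's rule at a vertex: [x] minus the vertex is a combination of the two edge directions
    leaving it. For [x] in the polygon both weights are nonnegative, so the polygon lies in the cone
    of its corner. *)
Lemma corner_coordinates vs i m x :
  cross (edge vs i) (edge vs (S i)) * dot m (vsub x (vtx vs (S i))) =
  cross (edge vs i) (vsub x (vtx vs i)) * dot m (edge vs (S i)) -
  cross (edge vs (S i)) (vsub x (vtx vs (S i))) * dot m (edge vs i).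
Proof. unfold edge. unvec. ring. Qed.

(** * Extreme vertices and cyclic order *)

Lemma lex_argmin {A : Type} (f g : A -> R) (l : list A) : l <> nil ->
  exists v, In v l /\ forall x, In x l -> f v < f x \/ (f v = f x /\ g v <= g x).
Proof.
  induction l as [|a l IH]; intros H; [easy|].
  destruct l as [|b l].
  - exists a. split; [now left|]. intros x [->|[]]. right; split; lra.
  - destruct IH as [v [Hv Hm]]; [easy|].
    destruct (Rlt_le_dec (f a) (f v)) as [L|L];
      [|destruct (Rlt_le_dec (f v) (f a)) as [L'|L'];
        [|destruct (Rle_lt_dec (g a) (g v)) as [L2|L2]]].
    + exists a. split; [now left|]. intros x [->|Hx]; [right; split; lra|].
      destruct (Hm x Hx); lra.
    + exists v. split; [now right|]. intros x [->|Hx]; [lra|auto].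
    + exists a. split; [now left|]. intros x [->|Hx]; [right; split; lra|].
      destruct (Hm x Hx); [left; lra|right; lra].
    + exists v. split; [now right|]. intros x [->|Hx]; [right; lra|auto].
Qed.

(** A vertex that is minimal against its two neighbours is minimal on the whole corner cone. The
    tie-break by [m'] serves to show that the contact closest to an apex is a vertex. *)
Lemma region_lex_min n vs m m' : convex_polygon_vertices n vs ->
  exists v, In v vs /\ forall x, polygon_region vs x ->
    dot m v < dot m x \/ (dot m v = dot m x /\ dot m' v <= dot m' x).
Proof.
  intros C. pose proof C as (Hn & Hl & _).
  destruct (lex_argmin (dot m) (dot m') vs) as [v [Hv Hm]].
  { intros ->. cbn in Hl. lia. }
  exists v. split; auto. intros x Hx.
  destruct (vertex_succ n vs v C Hv) as [i Hi].
  assert (LN : (0 < length vs)%nat) by lia.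
  pose proof (Hm _ (vtx_In vs i LN)) as H1.
  pose proof (Hm _ (vtx_In vs (S (S i)) LN)) as H2.
  pose proof (region_left n vs i x C Hx) as A.
  pose proof (region_left n vs (S i) x C Hx) as B.
  pose proof (edge_turn_left n vs i C) as P.
  pose proof (corner_coordinates vs i m x) as E.
  pose proof (corner_coordinates vs i m' x) as E'.
  rewrite <- Hi in *.
  assert (D1 : forall k, dot k (edge vs i) = dot k v - dot k (vtx vs i))
    by (intros k; unfold edge; rewrite <- Hi; unvec; ring).
  assert (D2 : forall k, dot k (edge vs (S i)) = dot k (vtx vs (S (S i))) - dot k v)
    by (intros k; unfold edge; rewrite <- Hi; unvec; ring).
  assert (D3 : forall k, dot k (vsub x v) = dot k x - dot k v)
    by (intros k; unvec; ring).
  rewrite D1, D2, D3 in E. rewrite D1, D2, D3 in E'.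
  set (a := cross (edge vs i) (vsub x (vtx vs i))) in *.
  set (b := cross (edge vs (S i)) (vsub x v)) in *.
  set (c := cross (edge vs i) (edge vs (S i))) in *.
  assert (F1 : 0 <= a * (dot m (vtx vs (S (S i))) - dot m v))
    by (apply Rmult_le_pos; lra).
  assert (F2 : 0 <= b * (dot m (vtx vs i) - dot m v))
    by (apply Rmult_le_pos; lra).
  destruct (Rlt_le_dec (dot m v) (dot m x)) as [L|L]; [now left|].
  (* In a tie for [m] both weighted terms vanish: each edge has weight zero or is itself a tie, and
     there the neighbour obeys the bound for [m']. *)
  assert (Z : c * (dot m x - dot m v) <= 0) by nra.
  assert (Z1 : a * (dot m (vtx vs (S (S i))) - dot m v) = 0) by lra.
  assert (Z2 : b * (dot m (vtx vs i) - dot m v) = 0) by lra.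
  right. split; [nra|].
  assert (G1 : 0 <= a * (dot m' (vtx vs (S (S i))) - dot m' v)).
  { destruct (Rmult_integral _ _ Z1) as [->|Q]; [lra|].
    apply Rmult_le_pos; auto. destruct H2; lra. }
  assert (G2 : 0 <= b * (dot m' (vtx vs i) - dot m' v)).
  { destruct (Rmult_integral _ _ Z2) as [->|Q]; [lra|].
    apply Rmult_le_pos; auto. destruct H1; lra. }
  nra.
Qed.

(** For a vertex [v], this says that [m] lies in the inner normal cone at [v]. The zero vector is
    included. *)
Definition supports (vs : list point) (m v : point) : Prop :=
  forall k, In k vs -> dot m v <= dot m k.

(* Normal cones at the vertices are smaller than a right angle because all internal angles are obtuse. *)
Lemma supports_acute n vs v m m' : convex_polygon_vertices n vs -> obtuse vs ->
  In v vs -> m <> origin -> m' <> origin ->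
  supports vs m v -> supports vs m' v -> 0 < dot m m'.
Proof.
  intros C Ob Hv Nm Nm' Sm Sm'. pose proof C as (Hn & Hl & _).
  destruct (vertex_succ n vs v C Hv) as [i ->].
  assert (LN : (0 < length vs)%nat) by lia.
  pose proof (edge_turn_left n vs i C) as P.
  pose proof (edge_dot_pos n vs i C Ob) as Q.
  assert (K : forall k, k <> origin -> supports vs k (vtx vs (S i)) ->
    0 <= dot k (edge vs (S i)) /\ 0 <= - dot k (edge vs i) /\
    0 < dot k (edge vs (S i)) - dot k (edge vs i)).
  { intros k Nk Sk. pose proof (Sk _ (vtx_In vs i LN)) as H1.
    pose proof (Sk _ (vtx_In vs (S (S i)) LN)) as H2.
    assert (D1 : dot k (edge vs i) = dot k (vtx vs (S i)) - dot k (vtx vs i))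
      by (unfold edge; unvec; ring).
    assert (D2 : dot k (edge vs (S i)) = dot k (vtx vs (S (S i))) - dot k (vtx vs (S i)))
      by (unfold edge; unvec; ring).
    repeat split; try lra.
    destruct (Rlt_le_dec 0 (dot k (edge vs (S i)) - dot k (edge vs i))) as [L|L]; auto.
    exfalso. apply Nk.
    assert (Z1 : dot k (edge vs (S i)) = 0) by lra.
    assert (Z2 : dot k (edge vs i) = 0) by lra.
    exact (independent_dot _ _ k P Z2 Z1). }
  destruct (K m Nm Sm) as (p0 & r0 & s0). destruct (K m' Nm' Sm') as (p1 & r1 & s1).
  set (e := edge vs i) in *; set (f := edge vs (S i)) in *.
  (* [dot m m'] is expanded through the products with the edges. The signs from [K] and
     [dot e f > 0] make every term nonnegative; [s0] and [s1] make one of them positive. *)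
  assert (Id : cross e f * cross e f * dot m m' =
     dot m f * dot m' f * dot e e + (- dot m e) * (- dot m' e) * dot f f
     + (dot m f * (- dot m' e) + (- dot m e) * dot m' f) * dot e f)
    by (unvec; ring).
  assert (e0 : 0 < dot e e).
  { apply dot_self_pos. intros ->. unfold origin in P; unvec. lra. }
  assert (f0 : 0 < dot f f).
  { apply dot_self_pos. intros ->. unfold origin in P; unvec. lra. }
  set (a := dot m f) in *; set (b := - dot m e) in *.
  set (a' := dot m' f) in *; set (b' := - dot m' e) in *.
  assert (0 < a * a' * dot e e + b * b' * dot f f + (a * b' + b * a') * dot e f).
  { assert (0 <= a * a' * dot e e) by (apply Rmult_le_pos; [nra|lra]).
    assert (0 <= b * b' * dot f f) by (apply Rmult_le_pos; [nra|lra]).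
    assert (0 <= a * b' * dot e f) by (apply Rmult_le_pos; [nra|lra]).
    assert (0 <= b * a' * dot e f) by (apply Rmult_le_pos; [nra|lra]).
    destruct (Req_dec a 0) as [a0|a0]; destruct (Req_dec a' 0) as [a0'|a0'].
    - assert (0 < b * b' * dot f f); [|lra].
      apply Rmult_lt_0_compat; auto. apply Rmult_lt_0_compat; subst b b'; lra.
    - assert (0 < b * a' * dot e f); [|lra].
      apply Rmult_lt_0_compat; auto. apply Rmult_lt_0_compat; subst b; lra.
    - assert (0 < a * b' * dot e f); [|lra].
      apply Rmult_lt_0_compat; auto. apply Rmult_lt_0_compat; subst b'; lra.
    - assert (0 < a * a' * dot e e); [|lra].
      apply Rmult_lt_0_compat; auto. apply Rmult_lt_0_compat; lra. }
  rewrite <- Id in H. 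
  destruct (Rlt_le_dec 0 (dot m m')) as [L|L]; auto.
  assert (0 < cross e f * cross e f) by nra. nra.
Qed.

(** The sum of the inner normals of the two edges at [v] works: a point where both normals give zero
    lies on both edge lines, hence is [v]. *)
Lemma vertex_exposed n vs v : convex_polygon_vertices n vs -> In v vs ->
  exists m, forall k, In k vs -> k <> v -> 0 < dot m (vsub k v).
Proof.
  intros C Hv. destruct (vertex_succ n vs v C Hv) as [i ->].
  pose proof (edge_turn_left n vs i C) as P.
  exists (vadd (perp (edge vs i)) (perp (edge vs (S i)))). intros k Hk Nk.
  pose proof (weakly_left n vs i k C Hk) as A.
  pose proof (weakly_left n vs (S i) k C Hk) as B.
  set (e := edge vs i) in *; set (f := edge vs (S i)) in *.
  assert (A' : cross e (vsub k (vtx vs i)) = cross e (vsub k (vtx vs (S i))))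
    by (subst e; unfold edge; unvec; ring).
  rewrite A' in A.
  replace (dot _ _) with (cross e (vsub k (vtx vs (S i))) + cross f (vsub k (vtx vs (S i))))
    by (unvec; ring).
  set (t := vsub k (vtx vs (S i))) in *.
  destruct (Rlt_le_dec 0 (cross e t + cross f t)) as [L|L]; auto.
  assert (Z1 : cross e t = 0) by lra. assert (Z2 : cross f t = 0) by lra.
  exfalso. exact (vsub_neq _ _ Nk (independent_cross e f t P Z1 Z2)).
Qed.

(** A [w] with no vertex strictly to the left of the line from [b] to [w] must be the cyclic
    predecessor of [b]. A nonempty set closed under predecessors goes all the way round. *)
Lemma predecessor_closed n vs K : convex_polygon_vertices n vs -> incl K vs -> K <> nil ->
  (forall b, In b K -> exists w, In w K /\ w <> b /\
     forall k, In k vs -> cross (vsub w b) (vsub k b) <= 0) ->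
  incl vs K.
Proof.
  intros C HK NK H. pose proof C as (Hn & Hl & _).
  assert (LN : (0 < length vs)%nat) by lia.
  assert (St : forall i, In (vtx vs (S i)) K -> In (vtx vs i) K).
  { intros i Hi. destruct (H _ Hi) as (w & Hw & Nw & Hr).
    destruct (strictly_left n vs i w C (HK _ Hw)) as [<-|[E|L]]; [assumption|contradiction|].
    exfalso. pose proof (Hr _ (vtx_In vs i LN)). unfold edge in L. unvec. lra. }
  assert (St' : forall m i, In (vtx vs (m + i)) K -> In (vtx vs i) K).
  { induction m; auto. }
  destruct K as [|b K]; [easy|].
  destruct (polygon_vertex_index vs b) as [i [Hi Eb]]; [apply HK; now left|].
  intros v Hv. destruct (polygon_vertex_index vs v Hv) as [j [Hj ->]].
  apply (St' (i + length vs - j)%nat).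
  replace (i + length vs - j + j)%nat with (i + length vs)%nat by lia.
  rewrite vtx_period, <- Eb. now left.
Qed.

Lemma argmax {A : Type} (f : A -> R) (l : list A) : l <> nil ->
  exists v, In v l /\ forall x, In x l -> f x <= f v.
Proof.
  intros H. destruct (lex_argmin (fun x => - f x) (fun _ => 0) l H) as [v [Hv Hm]].
  exists v. split; auto. intros x Hx. destruct (Hm x Hx); lra.
Qed.

(** Seen from the vertex [b], the other vertices fill less than a half-turn, so they are ordered by
    slope relative to an exposing direction [m]. The largest slope gives [w]. *)
Lemma last_around n vs K b : convex_polygon_vertices n vs -> incl K vs -> In b vs ->
  (exists k, In k K /\ k <> b) ->
  exists w, In w K /\ w <> b /\ forall k, In k K -> cross (vsub w b) (vsub k b) <= 0.
Proof.
  intros C HK Hb [k0 [Hk0 Nk0]].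
  destruct (vertex_exposed n vs b C Hb) as [m Hm].
  pose (dec := fun k : point => if excluded_middle_informative (k <> b) then true else false).
  assert (HD : forall k, In k (filter dec K) <-> In k K /\ k <> b).
  { intros k. rewrite filter_In. unfold dec.
    destruct excluded_middle_informative; intuition congruence. }
  destruct (argmax (fun k => cross m (vsub k b) / dot m (vsub k b)) (filter dec K))
    as [w [Hw Mw]].
  { intros E. pose proof (proj2 (HD k0) (conj Hk0 Nk0)) as X. rewrite E in X. destruct X. }
  apply HD in Hw. destruct Hw as [Hw Nw]. exists w. repeat split; auto.
  intros k Hk. destruct (classic (k = b)) as [->|Nk].
  { unvec. lra. }
  assert (Q := Mw k (proj2 (HD k) (conj Hk Nk))). cbn beta in Q.
  pose proof (Hm k (HK _ Hk) Nk) as P1. pose proof (Hm w (HK _ Hw) Nw) as P2.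
  assert (Id : dot m m * cross (vsub w b) (vsub k b) =
    dot m (vsub w b) * cross m (vsub k b) - cross m (vsub w b) * dot m (vsub k b))
    by (unvec; ring).
  assert (Nm : 0 < dot m m).
  { apply dot_self_pos. intros ->. unfold origin in P1; unvec; lra. }
  assert (dot m (vsub w b) * cross m (vsub k b) <= cross m (vsub w b) * dot m (vsub k b)).
  { apply (Rmult_le_compat_r (dot m (vsub k b) * dot m (vsub w b))) in Q; [|nra].
    replace (cross m (vsub k b) / dot m (vsub k b) * (dot m (vsub k b) * dot m (vsub w b)))
      with (dot m (vsub w b) * cross m (vsub k b)) in Q by (field; lra).
    replace (cross m (vsub w b) / dot m (vsub w b) * (dot m (vsub k b) * dot m (vsub w b)))
      with (cross m (vsub w b) * dot m (vsub k b)) in Q by (field; lra).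
    exact Q. }
  nra.
Qed.

(** * Existence and outcome of a probe *)

Lemma supports_region n vs m v x : convex_polygon_vertices n vs -> supports vs m v ->
  polygon_region vs x -> dot m v <= dot m x.
Proof.
  intros C S Hx. destruct (region_lex_min n vs m m C) as (w & Hw & H).
  specialize (S w Hw). destruct (H x Hx); lra.
Qed.

Lemma continuity_Rmin f g : continuity f -> continuity g ->
  continuity (fun t => Rmin (f t) (g t)).
Proof.
  intros Hf Hg.
  assert (E : forall t, Rmin (f t) (g t) = (f t + g t - Rabs (f t - g t)) * / 2).
  { intros t. unfold Rmin, Rabs. destruct Rle_dec, Rcase_abs; lra. }
  apply functional_extensionality in E. rewrite E. intros t.
  apply continuity_pt_mult with (f1 := fun t => f t + g t - Rabs (f t - g t)).
  - apply continuity_pt_minus with (f1 := fun t => f t + g t).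
    + apply continuity_pt_plus with (f1 := f); auto.
    + apply (continuity_pt_comp (fun t => f t - g t) Rabs).
      * apply continuity_pt_minus with (f1 := f); auto.
      * apply Rcontinuity_abs.
  - apply continuity_pt_const. now intros ? ?.
Qed.

(** The lower envelope comes with a minimiser at every parameter; it will give the supporting lines
    of a turning wedge. *)
Lemma continuous_min {A : Type} (f : A -> R -> R) (l : list A) : l <> nil ->
  (forall v, continuity (f v)) ->
  exists F, continuity F /\
    forall t, (forall v, In v l -> F t <= f v t) /\ exists v, In v l /\ F t = f v t.
Proof.
  intros Hl Hc. induction l as [|a l IH]; [easy|]. destruct l as [|b l].
  - exists (f a). split; auto. intros t. split.
    + intros v [->|[]]; lra.
    + exists a; split; [now left|auto].
  - destruct IH as (F & CF & HF); [easy|].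
    exists (fun t => Rmin (f a t) (F t)). split; [now apply continuity_Rmin|].
    intros t. destruct (HF t) as (Hle & v & Hv & Ev). split.
    + intros w [<-|Hw]; [apply Rmin_l|].
      apply Rle_trans with (F t); [apply Rmin_r|auto].
    + unfold Rmin. destruct Rle_dec.
      * exists a; split; [now left|auto].
      * exists v; split; [now right|auto].
Qed.

(** A right-angled wedge is a quadrant: up to the factor [dot u u], the values of [dot u] and
    [cross u] are the coordinates along [H1] and [H2]. *)
Lemma in_wedge_coordinates q u x : u <> origin ->
  0 <= dot u (vsub x q) -> 0 <= cross u (vsub x q) -> in_wedge (PI / 2) q u x.
Proof.
  intros Nu Hd Hc. pose proof (dot_self_pos u Nu) as P.
  exists (dot u (vsub x q) / dot u u), (cross u (vsub x q) / dot u u).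
  repeat split; try (apply Rmult_le_pos; [assumption|left; now apply Rinv_0_lt_compat]).
  rewrite rot_half_pi.
  apply point_eq; unvec; field; lra.
Qed.

Lemma on_ray_coordinates q u x : u <> origin ->
  0 <= dot u (vsub x q) -> cross u (vsub x q) = 0 -> on_ray q u x.
Proof.
  intros Nu Hd Hc. pose proof (dot_self_pos u Nu) as P.
  exists (dot u (vsub x q) / dot u u).
  split; [apply Rmult_le_pos; [assumption|left; now apply Rinv_0_lt_compat]|].
  apply (dot_cross_eq u); auto.
  - unvec; field; lra.
  - replace (cross u x) with (cross u (vsub x q) + cross u q) by (unvec; ring).
    rewrite Hc. unvec; ring.
Qed.

Lemma in_wedge_elim q u x : in_wedge (PI / 2) q u x ->
  0 <= dot u (vsub x q) /\ 0 <= cross u (vsub x q).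
Proof.
  intros (s & t & Hs & Ht & ->). rewrite rot_half_pi.
  assert (0 <= dot u u) by (unvec; nra).
  split.
  - replace (dot _ _) with (s * dot u u) by (unvec; ring). nra.
  - replace (cross _ _) with (t * dot u u) by (unvec; ring). nra.
Qed.

(* Turn the wedge by a right angle from [H2] along [d] to [H1] along [d]: the point [a],
   seen from the apex, passes from one side of the direction [d] to the other. *)
Lemma valid_probe_exists n vs a d : convex_polygon_vertices n vs ->
  polygon_region vs a -> d <> origin ->
  exists q u, valid_probe (PI / 2) (polygon_region vs) (a, d) q u.
Proof.
  intros C Ha Nd. pose proof C as (Hn & Hl & _).
  assert (Nvs : vs <> nil) by (intros ->; cbn in Hl; lia).
  pose proof (dot_self_pos d Nd) as Pd.
  (* Leaving [u t] unnormalised makes its products with fixed points affine in [t]. At 0 the ray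
     [H2] has direction [d], at 1 the ray [H1] does. *)
  pose (u := fun t => vsub (vscale t d) (vscale (1 - t) (perp d))).
  assert (Cd : forall x y : R, continuity (fun t => x + t * y)).
  { intros x y. apply continuity_plus with (f1 := fun _ => x).
    - apply continuity_const. now intros ? ?.
    - apply continuity_mult with (f1 := fun t => t).
      + apply derivable_continuous, derivable_id.
      + apply continuity_const. now intros ? ?. }
  destruct (continuous_min (fun v t => dot (u t) v) vs Nvs) as (F & CF & HF).
  { intros v. replace (fun t => dot (u t) v) with
      (fun t => - cross d v + t * (dot d v + cross d v)); [apply Cd|].
    apply functional_extensionality. intros t. unfold u; unvec; ring. }
  destruct (continuous_min (fun v t => cross (u t) v) vs Nvs) as (G & CG & HG).
  { intros v. replace (fun t => cross (u t) v) with
      (fun t => dot d v + t * (cross d v - dot d v)); [apply Cd|].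
    apply functional_extensionality. intros t. unfold u; unvec; ring. }
  assert (RF : forall t x, polygon_region vs x -> F t <= dot (u t) x).
  { intros t x Hx. destruct (HF t) as (H & v & Hv & E). rewrite E.
    apply (supports_region n vs); auto. intros k Hk. rewrite <- E. auto. }
  assert (RG : forall t x, polygon_region vs x -> G t <= cross (u t) x).
  { intros t x Hx. destruct (HG t) as (H & v & Hv & E). rewrite E.
    replace (cross (u t) v) with (dot (perp (u t)) v) by (unvec; ring).
    replace (cross (u t) x) with (dot (perp (u t)) x) by (unvec; ring).
    apply (supports_region n vs); auto. intros k Hk.
    replace (dot (perp (u t)) v) with (cross (u t) v) by (unvec; ring).
    replace (dot (perp (u t)) k) with (cross (u t) k) by (unvec; ring).
    rewrite <- E. auto. }
  (* The apex is to be where the supporting lines [dot = F t] and [cross = G t] meet. From there [a]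
     has coordinates [al t], [be t], while [d] has coordinates proportional to [t], [1 - t];
     [h t = 0] says that they are parallel. *)
  pose (al := fun t => dot (u t) a - F t). pose (be := fun t => cross (u t) a - G t).
  pose (h := fun t => t * be t - (1 - t) * al t).
  assert (Ch : continuity h).
  { assert (Hal : al = fun t => (- cross d a + t * (dot d a + cross d a)) - F t).
    { apply functional_extensionality. intros t. unfold al, u; unvec; ring. }
    assert (Hbe : be = fun t => (dot d a + t * (cross d a - dot d a)) - G t).
    { apply functional_extensionality. intros t. unfold be, u; unvec; ring. }
    assert (Cal : continuity al)
      by (rewrite Hal; apply continuity_minus with (f2 := F); auto).
    assert (Cbe : continuity be)
      by (rewrite Hbe; apply continuity_minus with (f2 := G); auto).
    assert (Cid : continuity (fun t => t)) by apply derivable_continuous, derivable_id.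
    assert (C1 : continuity (fun t => 1 - t)).
    { apply continuity_minus with (f1 := fun _ => 1); auto.
      apply continuity_const. now intros ? ?. }
    apply continuity_minus with (f1 := fun t => t * be t) (f2 := fun t => (1 - t) * al t).
    - apply continuity_mult with (f1 := fun t => t); auto.
    - apply continuity_mult with (f1 := fun t => 1 - t); auto. }
  assert (Pal : forall t, 0 <= al t) by (intros t; pose proof (RF t a Ha); unfold al; lra).
  assert (Pbe : forall t, 0 <= be t) by (intros t; pose proof (RG t a Ha); unfold be; lra).
  destruct (IVT_cor h 0 1 Ch) as (t & Ht & Et); [lra| |].
  { unfold h. pose proof (Pal 0); pose proof (Pbe 1). nra. }
  unfold h in Et. specialize (Pal t); specialize (Pbe t).
  assert (Nt : 0 < t * t + (1 - t) * (1 - t)) by nra.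
  assert (Euu : dot (u t) (u t) = (t * t + (1 - t) * (1 - t)) * dot d d)
    by (unfold u; unvec; ring).
  assert (Nu : u t <> origin).
  { intros E. rewrite E in Euu. unfold origin in Euu. unvec. nra. }
  (* The factor in [a - q = lam * d], found by projecting onto [d]. Its sign puts [a] on the ray
     from [q] along [d]. *)
  set (lam := (t * al t + (1 - t) * be t) / ((t * t + (1 - t) * (1 - t)) * dot d d)).
  assert (Plam : 0 <= lam).
  { apply Rmult_le_pos; [nra|]. left. apply Rinv_0_lt_compat. nra. }
  set (q := vadd a (vscale (- lam) d)).
  assert (Dq : forall x, dot (u t) (vsub x q) = dot (u t) x - F t).
  { intros x.
    replace (dot (u t) (vsub x q)) with (dot (u t) x - dot (u t) a + lam * dot (u t) d)
      by (unfold q; unvec; ring).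
    replace (dot (u t) d) with (t * dot d d) by (unfold u; unvec; ring).
    assert (lam * (t * dot d d) = al t).
    { apply (Rmult_eq_reg_r (t * t + (1 - t) * (1 - t))); [|lra].
      replace (lam * (t * dot d d) * (t * t + (1 - t) * (1 - t)))
        with ((t * al t + (1 - t) * be t) * t) by (unfold lam; field; lra).
      replace ((t * al t + (1 - t) * be t) * t)
        with (t * t * al t + (1 - t) * (t * be t)) by ring.
      replace (t * be t) with ((1 - t) * al t) by lra. ring. }
    unfold al in H. lra. }
  assert (Cq : forall x, cross (u t) (vsub x q) = cross (u t) x - G t).
  { intros x.
    replace (cross (u t) (vsub x q)) with (cross (u t) x - cross (u t) a + lam * cross (u t) d)
      by (unfold q; unvec; ring).
    replace (cross (u t) d) with ((1 - t) * dot d d) by (unfold u; unvec; ring).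
    assert (lam * ((1 - t) * dot d d) = be t).
    { apply (Rmult_eq_reg_r (t * t + (1 - t) * (1 - t))); [|lra].
      replace (lam * ((1 - t) * dot d d) * (t * t + (1 - t) * (1 - t)))
        with ((t * al t + (1 - t) * be t) * (1 - t)) by (unfold lam; field; lra).
      replace ((t * al t + (1 - t) * be t) * (1 - t))
        with (t * ((1 - t) * al t) + (1 - t) * (1 - t) * be t) by ring.
      replace ((1 - t) * al t) with (t * be t) by lra. ring. }
    unfold be in H. lra. }
  exists q, (u t). repeat split.
  - exact Nu.
  - exists (- lam). reflexivity.
  - intros x Hx. apply in_wedge_coordinates; auto.
    + rewrite Dq. pose proof (RF t x Hx). lra.
    + rewrite Cq. pose proof (RG t x Hx). lra.
  - destruct (HG t) as (_ & v & Hv & E). exists v.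
    assert (Ov : polygon_region vs v) by (apply (vertex_in_region n); auto).
    split; auto. apply on_ray_coordinates; auto.
    + rewrite Dq. pose proof (RF t v Ov). lra.
    + rewrite Cq. lra.
  - destruct (HF t) as (_ & v & Hv & E). exists v.
    assert (Ov : polygon_region vs v) by (apply (vertex_in_region n); auto).
    split; auto. rewrite rot_half_pi. apply on_ray_coordinates; [now apply perp_neq| |].
    + replace (dot (perp (u t)) (vsub v q)) with (cross (u t) (vsub v q)) by (unvec; ring).
      rewrite Cq. pose proof (RG t v Ov). lra.
    + replace (cross (perp (u t)) (vsub v q)) with (- dot (u t) (vsub v q)) by (unvec; ring).
      rewrite Dq. lra.
  - exists a. split; auto. exists lam. split; auto. cbn [snd].
    unfold q. apply point_eq; unvec; ring.
Qed.

(** A hit in the frame of [u]: [H1] lies on the line where [cross u] vanishes, [H2] on the one where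
    [dot u] does. That the contacts are vertices and the apex is outside is not part of a response;
    [response_contact] derives it. *)
Record contact (vs : list point) (q u c1 c2 : point) : Prop := {
  contact_dir : u <> origin;
  contact_vertex1 : In c1 vs;
  contact_vertex2 : In c2 vs;
  contact_ray1 : cross u (vsub c1 q) = 0;
  contact_ray2 : dot u (vsub c2 q) = 0;
  contact_dot : forall x, polygon_region vs x -> 0 <= dot u (vsub x q);
  contact_cross : forall x, polygon_region vs x -> 0 <= cross u (vsub x q);
  contact_first1 : forall x, polygon_region vs x -> cross u (vsub x q) = 0 ->
    dot u (vsub c1 q) <= dot u (vsub x q);
  contact_first2 : forall x, polygon_region vs x -> dot u (vsub x q) = 0 ->
    cross u (vsub c2 q) <= cross u (vsub x q);
  contact_apex : ~ polygon_region vs q }.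

Lemma closest_first Og q u c : u <> origin -> closest_on_ray Og q u c ->
  Og c /\ cross u (vsub c q) = 0 /\ 0 <= dot u (vsub c q) /\
  forall x, Og x -> cross u (vsub x q) = 0 -> 0 <= dot u (vsub x q) ->
    dot u (vsub c q) <= dot u (vsub x q).
Proof.
  intros Nu (Oc & (s & Hs & ->) & Hmin). pose proof (dot_self_pos u Nu) as P.
  assert (E1 : dot u (vsub (vadd q (vscale s u)) q) = s * dot u u) by (unvec; ring).
  rewrite E1. repeat split; auto.
  - unvec; ring.
  - nra.
  - intros x Ox Cx Dx.
    pose proof (on_ray_coordinates q u x Nu Dx Cx) as Rx.
    specialize (Hmin x Ox Rx). destruct Rx as (s' & Hs' & ->).
    replace (dot u (vsub (vadd q (vscale s' u)) q)) with (s' * dot u u) by (unvec; ring).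
    unfold pdist, vnorm in Hmin. apply sqrt_le_0 in Hmin; [| unvec; nra | unvec; nra].
    assert (s * s * dot u u <= s' * s' * dot u u) by (unvec; lra).
    assert (s * s <= s' * s') by nra. assert (s <= s') by nra. nra.
Qed.

(** The contact closest to the apex is a lexicographic minimiser, hence a vertex, for each ray. *)
Lemma response_contact n vs L q u c1 c2 : convex_polygon_vertices n vs -> obtuse vs ->
  valid_response (PI / 2) (polygon_region vs) L (Hit q u c1 c2) ->
  contact vs q u c1 c2 /\ on_line L q /\
  exists x, polygon_region vs x /\ on_ray q (snd L) x.
Proof.
  intros C Ob ((Nu & OL & W & _ & _ & Far) & K1 & K2).
  rewrite rot_half_pi in K2.
  apply closest_first in K1; auto. apply closest_first in K2; [|now apply perp_neq].
  destruct K1 as (O1 & R1 & P1 & M1). destruct K2 as (O2 & R2 & P2 & M2).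
  assert (Wd : forall x, polygon_region vs x -> 0 <= dot u (vsub x q))
    by (intros x Hx; apply in_wedge_elim; auto).
  assert (Wc : forall x, polygon_region vs x -> 0 <= cross u (vsub x q))
    by (intros x Hx; apply in_wedge_elim; auto).
  assert (T1 : forall x, dot (perp u) (vsub x q) = cross u (vsub x q)) by (intros; unvec; ring).
  assert (T2 : forall x, cross (perp u) (vsub x q) = - dot u (vsub x q)) by (intros; unvec; ring).
  rewrite T2 in R2.
  assert (M2' : forall x, polygon_region vs x -> dot u (vsub x q) = 0 ->
    cross u (vsub c2 q) <= cross u (vsub x q)).
  { intros x Hx Ex. rewrite <- !T1. apply M2; auto.
    - rewrite T2; lra.
    - rewrite T1; auto. }
  assert (D3 : forall k x y, dot k (vsub x y) = dot k x - dot k y) by (intros; unvec; ring).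
  assert (D4 : forall k x y, cross k (vsub x y) = cross k x - cross k y) by (intros; unvec; ring).
  assert (D5 : forall x, dot (perp u) x = cross u x) by (intros; unvec; ring).
  assert (V1 : In c1 vs).
  { destruct (region_lex_min n vs (perp u) u C) as (v & Hv & Hm).
    pose proof (vertex_in_region n vs v C Hv) as Ov.
    specialize (Hm c1 O1). rewrite !D5 in Hm.
    pose proof (Wc v Ov) as X. rewrite D4 in X, R1.
    assert (Y : cross u (vsub v q) = 0) by (rewrite D4; lra).
    specialize (M1 v Ov Y (Wd v Ov)). rewrite !D3 in M1. rewrite D4 in Y.
    replace c1 with v; auto. apply (dot_cross_eq u); auto; lra. }
  assert (V2 : In c2 vs).
  { destruct (region_lex_min n vs u (perp u) C) as (v & Hv & Hm).
    pose proof (vertex_in_region n vs v C Hv) as Ov.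
    specialize (Hm c2 O2). rewrite !D5 in Hm.
    pose proof (Wd v Ov) as X. rewrite D3 in X, R2.
    assert (Y : dot u (vsub v q) = 0) by (rewrite D3; lra).
    specialize (M2' v Ov Y). rewrite !D4 in M2'. rewrite D3 in Y.
    replace c2 with v; auto. apply (dot_cross_eq u); auto; lra. }
  split; [constructor; auto; try lra | split; [exact OL|exact Far]].
  (* An apex in the polygon would be a vertex supported by the orthogonal directions [u] and
     [perp u]. *)
  intros Oq. destruct (region_lex_min n vs u (perp u) C) as (v & Hv & Hm).
  pose proof (vertex_in_region n vs v C Hv) as Ov.
  specialize (Hm q Oq). rewrite !D5 in Hm.
  pose proof (Wd v Ov) as X. pose proof (Wc v Ov) as Y. rewrite D3 in X. rewrite D4 in Y.
  assert (v = q) as -> by (apply (dot_cross_eq u); auto; lra).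
  assert (0 < dot u (perp u)); [|unvec; lra].
  apply (supports_acute n vs q); auto; [now apply perp_neq| |].
  - intros k Hk. pose proof (Wd k (vertex_in_region n vs k C Hk)) as Z. rewrite D3 in Z. lra.
  - intros k Hk. pose proof (Wc k (vertex_in_region n vs k C Hk)) as Z. rewrite D4 in Z.
    rewrite !D5. lra.
Qed.

(** * Probing along the line through two vertices *)

Lemma dot_vsub m x y : dot m (vsub x y) = dot m x - dot m y.
Proof. unvec; ring. Qed.

Lemma cross_vsub m x y : cross m (vsub x y) = cross m x - cross m y.
Proof. unvec; ring. Qed.

Lemma dot_perp m x : dot (perp m) x = cross m x.
Proof. unvec; ring. Qed.

Lemma contact_supports2 n vs q u c1 c2 : convex_polygon_vertices n vs ->
  contact vs q u c1 c2 -> supports vs u c2.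
Proof.
  intros C K k Hk. pose proof (contact_dot _ _ _ _ _ K k (vertex_in_region n vs k C Hk)) as H.
  pose proof (contact_ray2 _ _ _ _ _ K) as E. rewrite dot_vsub in *. lra.
Qed.

Lemma contact_supports1 n vs q u c1 c2 : convex_polygon_vertices n vs ->
  contact vs q u c1 c2 -> supports vs (perp u) c1.
Proof.
  intros C K k Hk. pose proof (contact_cross _ _ _ _ _ K k (vertex_in_region n vs k C Hk)) as H.
  pose proof (contact_ray1 _ _ _ _ _ K) as E. rewrite cross_vsub in *. rewrite !dot_perp. lra.
Qed.

Lemma contact_beyond1 n vs q u c1 c2 : convex_polygon_vertices n vs ->
  contact vs q u c1 c2 -> 0 < dot u (vsub c1 q).
Proof.
  intros C K. pose proof (vertex_in_region n vs c1 C (contact_vertex1 _ _ _ _ _ K)) as O1.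
  destruct (contact_dot _ _ _ _ _ K c1 O1) as [H|H]; [exact H|].
  exfalso. apply (contact_apex _ _ _ _ _ K). replace q with c1; auto.
  apply (dot_cross_sub_eq u); [apply K|auto|apply K].
Qed.

Lemma contact_beyond2 n vs q u c1 c2 : convex_polygon_vertices n vs ->
  contact vs q u c1 c2 -> 0 < cross u (vsub c2 q).
Proof.
  intros C K. pose proof (vertex_in_region n vs c2 C (contact_vertex2 _ _ _ _ _ K)) as O1.
  destruct (contact_cross _ _ _ _ _ K c2 O1) as [H|H]; [exact H|].
  exfalso. apply (contact_apex _ _ _ _ _ K). replace q with c2; auto.
  apply (dot_cross_sub_eq u); [apply K|apply K|auto].
Qed.

Lemma contact_distinct n vs q u c1 c2 : convex_polygon_vertices n vs -> obtuse vs ->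
  contact vs q u c1 c2 -> c1 <> c2.
Proof.
  intros C Ob K ->. pose proof (contact_dir _ _ _ _ _ K) as Nu.
  assert (0 < dot u (perp u)); [|unvec; lra].
  apply (supports_acute n vs c2); auto.
  - apply K.
  - now apply perp_neq.
  - now apply (contact_supports2 n vs q u c2 c2).
  - now apply (contact_supports1 n vs q u c2 c2).
Qed.

(* The apex [q] lies on the line [b w], before [b], and [u] is the direction of [H1]. *)
Definition chord (q u b w : point) : Prop :=
  w <> b /\ 0 <= dot u (vsub w b) /\ 0 <= cross u (vsub w b) /\
  exists s, 0 < s /\ vsub b q = vscale s (vsub w b).

(** The visible point [x] is not the apex, so [d] points into the wedge. Were [b] behind the apex,
    [-d] would point into it too, impossible in a quadrant. *)
Lemma chord_probe vs q u c1 c2 b w : contact vs q u c1 c2 -> polygon_region vs b -> w <> b ->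
  on_line (b, vsub w b) q ->
  (exists x, polygon_region vs x /\ on_ray q (vsub w b) x) -> chord q u b w.
Proof.
  intros K Ob Nw (t & Eq) (x & Ox & (s & Hs & Ex)). cbn [fst snd] in Eq.
  set (d := vsub w b) in *.
  assert (Nd : d <> origin) by (apply vsub_neq; auto).
  assert (s <> 0).
  { intros ->. apply (contact_apex _ _ _ _ _ K). replace q with x; auto.
    subst x. apply point_eq; unvec; ring. }
  assert (Hd : 0 <= dot u d).
  { pose proof (contact_dot _ _ _ _ _ K x Ox) as H1.
    replace (dot u (vsub x q)) with (s * dot u d) in H1 by (rewrite Ex; unvec; ring). nra. }
  assert (Hc : 0 <= cross u d).
  { pose proof (contact_cross _ _ _ _ _ K x Ox) as H1.
    replace (cross u (vsub x q)) with (s * cross u d) in H1 by (rewrite Ex; unvec; ring). nra. }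
  assert (Eb : vsub b q = vscale (- t) d) by (rewrite Eq; apply point_eq; unvec; ring).
  repeat split; auto. exists (- t). split; auto.
  pose proof (contact_dot _ _ _ _ _ K b Ob) as H1. pose proof (contact_cross _ _ _ _ _ K b Ob) as H2.
  rewrite Eb in H1, H2.
  replace (dot u (vscale (- t) d)) with (- t * dot u d) in H1 by (unvec; ring).
  replace (cross u (vscale (- t) d)) with (- t * cross u d) in H2 by (unvec; ring).
  assert (t <> 0).
  { intros ->. apply (contact_apex _ _ _ _ _ K). replace q with b; auto.
    rewrite Eq. apply point_eq; unvec; ring. }
  destruct (Rlt_le_dec 0 (- t)) as [L|L]; auto. exfalso. apply Nd.
  apply (dot_cross_eq u); [apply K| |]; unfold origin.
  - replace (dot u (0, 0)) with 0 by (unvec; ring). nra.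
  - replace (cross u (0, 0)) with 0 by (unvec; ring). nra.
Qed.

(** If the second contact is [b], then [H2] runs along the probing line, and the polygon lies to its
    right. *)
Lemma chord_confirms n vs q u c1 w b : convex_polygon_vertices n vs ->
  contact vs q u c1 b -> chord q u b w ->
  dot u (vsub w b) = 0 /\ forall k, In k vs -> cross (vsub w b) (vsub k b) <= 0.
Proof.
  intros C K (Nw & Hd & Hc & s & Hs & Eb).
  pose proof (contact_ray2 _ _ _ _ _ K) as E. rewrite Eb in E.
  replace (dot u (vscale s (vsub w b))) with (s * dot u (vsub w b)) in E by (unvec; ring).
  assert (Z : dot u (vsub w b) = 0) by nra. split; auto.
  intros k Hk. pose proof (contact_supports2 n vs q u c1 b C K k Hk) as S.
  pose proof (dot_self_pos u (contact_dir _ _ _ _ _ K)) as P.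
  assert (Id : dot u u * cross (vsub w b) (vsub k b) =
     dot u (vsub w b) * cross u (vsub k b) - cross u (vsub w b) * dot u (vsub k b))
    by (unvec; ring).
  rewrite Z, (dot_vsub u k b) in Id. nra.
Qed.

Lemma chord_discovers n vs q u c1 c2 w b : convex_polygon_vertices n vs ->
  contact vs q u c1 c2 -> chord q u b w -> In b vs -> In w vs -> c2 <> b ->
  0 < cross (vsub w b) (vsub c2 b).
Proof.
  intros C K (Nw & Hd & Hc & s & Hs & Eb) Vb Vw Nc.
  pose proof (contact_beyond2 n vs q u c1 c2 C K) as B2.
  pose proof (contact_ray2 _ _ _ _ _ K) as R2.
  pose proof (dot_self_pos u (contact_dir _ _ _ _ _ K)) as P.
  set (d := vsub w b) in *.
  assert (E : cross d (vsub c2 b) = cross d (vsub c2 q)).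
  { replace (cross d (vsub c2 b)) with (cross d (vsub c2 q) - cross d (vsub b q))
      by (unvec; ring). rewrite Eb. unvec; ring. }
  assert (Id : dot u u * cross d (vsub c2 q) =
     dot u d * cross u (vsub c2 q) - cross u d * dot u (vsub c2 q))
    by (unvec; ring).
  rewrite R2 in Id. rewrite E.
  (* Either [d] points strictly off [H2], so that [c2] is on its left; or [H2] runs along [d], and
     then [c2], being closest to the apex, would put [b] between two other vertices. *)
  destruct Hd as [Hd|Hd].
  - assert (0 < dot u u * cross d (vsub c2 q)); [|nra].
    rewrite Id. pose proof (Rmult_lt_0_compat _ _ Hd B2). lra.
  - exfalso.
    destruct (vertex_exposed n vs b C Vb) as [m Hm].
    pose proof (Hm w Vw Nw) as M1. pose proof (Hm c2 (contact_vertex2 _ _ _ _ _ K) Nc) as M2.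
    fold d in M1.
    assert (Fb : cross u (vsub c2 q) <= cross u (vsub b q)).
    { apply K; [now apply (vertex_in_region n)|]. rewrite Eb.
      replace (dot u (vscale s d)) with (s * dot u d) by (unvec; ring). rewrite <- Hd; ring. }
    assert (Z : cross d (vsub c2 b) = 0) by (rewrite E; nra).
    assert (Cd : 0 < cross u d).
    { destruct Hc as [Hc|Hc]; auto. exfalso. apply (vsub_neq _ _ Nw).
      apply (dot_cross_eq u); [apply K| |]; fold d; unfold origin.
      - replace (dot u (0, 0)) with 0 by (unvec; ring). auto.
      - replace (cross u (0, 0)) with 0 by (unvec; ring). auto. }
    assert (Pl : cross u d * dot m (vsub c2 b) =
       cross u (vsub c2 b) * dot m d - cross d (vsub c2 b) * dot m u) by (unvec; ring).
    rewrite Z in Pl.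
    assert (cross u (vsub c2 b) <= 0) by (rewrite cross_vsub in *; rewrite cross_vsub in Fb; lra).
    nra.
Qed.

Lemma second_right n vs q u c1 c2 w b : convex_polygon_vertices n vs ->
  contact vs q u c1 c2 -> chord q u b w -> 0 < cross u (vsub w b) ->
  cross (vsub w b) (vsub c1 b) < 0.
Proof.
  intros C K (Nw & Hd & Hc & s & Hs & Eb) P.
  pose proof (contact_beyond1 n vs q u c1 c2 C K) as B1.
  pose proof (contact_ray1 _ _ _ _ _ K) as R1.
  pose proof (dot_self_pos u (contact_dir _ _ _ _ _ K)) as Pu.
  set (d := vsub w b) in *.
  assert (E : cross d (vsub c1 b) = cross d (vsub c1 q)).
  { replace (cross d (vsub c1 b)) with (cross d (vsub c1 q) - cross d (vsub b q))
      by (unvec; ring). rewrite Eb. unvec; ring. }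
  assert (Id : dot u u * cross d (vsub c1 q) =
     dot u d * cross u (vsub c1 q) - cross u d * dot u (vsub c1 q))
    by (unvec; ring).
  rewrite R1 in Id. rewrite E. nra.
Qed.

(** * The first two probes *)

Record opening (vs : list point) (q u p1 p2 q' u' x y : point) : Prop := {
  opening_first : contact vs q u p1 p2;
  opening_second : contact vs q' u' x y;
  opening_chord : chord q' u' p1 p2 }.

(* [u] lies between [u'] turned clockwise by a right angle and [u']. *)
Lemma opening_turn n vs q u p1 p2 q' u' x y : convex_polygon_vertices n vs ->
  opening vs q u p1 p2 q' u' x y ->
  0 <= dot u' u /\ 0 < cross u u' /\ 0 < cross u' (vsub p2 p1) /\
  0 < cross u' (vsub p1 x).
Proof.
  intros C [K K' (Nw & Hd & Hc & s & Hs & Eb)].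
  pose proof (dot_self_pos u (contact_dir _ _ _ _ _ K)) as Pu.
  pose proof (dot_self_pos u' (contact_dir _ _ _ _ _ K')) as N.
  pose proof (contact_supports1 n vs _ _ _ _ C K) as S1.
  pose proof (contact_supports2 n vs _ _ _ _ C K) as S2.
  pose proof (contact_beyond2 n vs _ _ _ _ C K') as Y0.
  pose proof (contact_ray2 _ _ _ _ _ K') as X0.
  pose proof (contact_ray1 _ _ _ _ _ K') as Yx.
  set (d := vsub p2 p1) in *.
  assert (I1 : forall v, dot u' u' * dot u v = dot u' u * dot u' v - cross u u' * cross u' v)
    by (intros v; unvec; ring).
  assert (I2 : forall v, dot u' u' * cross u v = cross u u' * dot u' v + dot u' u * cross u' v)
    by (intros v; unvec; ring).
  assert (D1 : dot u d <= 0).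
  { unfold d; rewrite dot_vsub. specialize (S2 p1 (contact_vertex1 _ _ _ _ _ K)). lra. }
  assert (D2 : 0 <= cross u d).
  { unfold d; rewrite cross_vsub. specialize (S1 p2 (contact_vertex2 _ _ _ _ _ K)).
    rewrite !dot_perp in S1. lra. }
  assert (D1' : dot u' u * dot u' d - cross u u' * cross u' d <= 0) by (rewrite <- I1; nra).
  assert (D2' : 0 <= cross u u' * dot u' d + dot u' u * cross u' d) by (rewrite <- I2; nra).
  assert (NX : ~ (dot u' d = 0 /\ cross u' d = 0)).
  { intros [E1 E2]. apply Nw. now apply (dot_cross_sub_eq u'); [apply K'| |]. }
  assert (Nu : ~ (dot u' u = 0 /\ cross u u' = 0)).
  { intros [E1 E2]. specialize (I1 u). rewrite E1, E2 in I1. nra. }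
  assert (Yy : 0 <= cross u u' * (0 - s * dot u' d)
                   + dot u' u * (cross u' (vsub y q') - s * cross u' d)).
  { specialize (S1 y (contact_vertex2 _ _ _ _ _ K')). rewrite !dot_perp in S1.
    assert (E : dot u' u' * (cross u y - cross u p1) =
       cross u u' * (dot u' (vsub y q') - dot u' (vsub p1 q'))
       + dot u' u * (cross u' (vsub y q') - cross u' (vsub p1 q'))) by (unvec; ring).
    rewrite X0, Eb in E.
    replace (dot u' (vscale s d)) with (s * dot u' d) in E by (unvec; ring).
    replace (cross u' (vscale s d)) with (s * cross u' d) in E by (unvec; ring).
    rewrite <- E. apply Rmult_le_pos; lra. }
  assert (Y2 : 0 <= dot u' u * (0 - (s + 1) * dot u' d)
                   - cross u u' * (cross u' (vsub y q') - (s + 1) * cross u' d)).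
  { specialize (S2 y (contact_vertex2 _ _ _ _ _ K')).
    assert (E : dot u' u' * (dot u y - dot u p2) =
       dot u' u * (dot u' (vsub y q') - (dot u' (vsub p1 q') + dot u' d))
       - cross u u' * (cross u' (vsub y q') - (cross u' (vsub p1 q') + cross u' d)))
      by (unfold d; unvec; ring).
    rewrite X0, Eb in E.
    replace (dot u' (vscale s d)) with (s * dot u' d) in E by (unvec; ring).
    replace (cross u' (vscale s d)) with (s * cross u' d) in E by (unvec; ring).
    replace (s * dot u' d + dot u' d) with ((s + 1) * dot u' d) in E by ring.
    replace (s * cross u' d + cross u' d) with ((s + 1) * cross u' d) in E by ring.
    rewrite <- E. apply Rmult_le_pos; lra. }
  assert (X2 : 0 <= cross u u' * (dot u' (vsub x q') - s * dot u' d)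
                   + dot u' u * (0 - s * cross u' d)).
  { specialize (S1 x (contact_vertex1 _ _ _ _ _ K')). rewrite !dot_perp in S1.
    assert (E : dot u' u' * (cross u x - cross u p1) =
       cross u u' * (dot u' (vsub x q') - dot u' (vsub p1 q'))
       + dot u' u * (cross u' (vsub x q') - cross u' (vsub p1 q'))) by (unvec; ring).
    rewrite Yx, Eb in E.
    replace (dot u' (vscale s d)) with (s * dot u' d) in E by (unvec; ring).
    replace (cross u' (vscale s d)) with (s * cross u' d) in E by (unvec; ring).
    rewrite <- E. apply Rmult_le_pos; lra. }
  assert (E1 : cross u' (vsub p1 x) = s * cross u' d).
  { replace (cross u' (vsub p1 x)) with (cross u' (vsub p1 q') - cross u' (vsub x q'))
      by (unvec; ring). rewrite Yx, Eb. unvec; ring. }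
  rewrite E1.
  set (A := dot u' u) in *; set (Bn := cross u u') in *.
  set (Xd := dot u' d) in *; set (Yd := cross u' d) in *.
  set (Y := cross u' (vsub y q')) in *; set (X := dot u' (vsub x q')) in *.
  (* What remains is arithmetic in the frame of [u']. The first wedge, supporting at [p1] and [p2],
     constrains [p2 - p1], [y] and [x]; [D1'] and [D2'] give the sign of [Bn], and [Yy] that of
     [A]. *)
  clearbody A Bn Xd Yd Y X. clear - Hs Hd Hc D1' D2' NX Nu Yy Y2 X2 Y0.
  assert (B0 : 0 <= Bn).
  { assert (0 <= Bn * (Xd * Xd + Yd * Yd)) by nra.
    assert (0 < Xd * Xd + Yd * Yd); [|nra].
    destruct Hd as [Hd|Hd]; [nra|]. destruct Hc as [Hc|Hc]; [nra|]. now destruct NX. }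
  assert (A0 : 0 <= A).
  { assert (0 <= A * Y); [|nra]. assert (0 <= s * (Bn * Xd + A * Yd)); [nra|lra]. }
  assert (Yd0 : 0 < Yd).
  { destruct Hc as [Hc|Hc]; auto. exfalso. subst Yd.
    assert (0 < Xd) by (destruct Hd; [auto|now destruct NX]).
    assert (A = 0) by nra. assert (0 < Bn) by (destruct B0; [auto|now destruct Nu]).
    nra. }
  repeat split; auto; [|nra].
  destruct B0 as [B0|B0]; auto. exfalso. subst Bn.
  assert (0 < A) by (destruct A0; [auto|now destruct Nu]).
  assert (0 < s * Yd) by nra. nra.
Qed.

(** A polygon point on the second [H1] other than [x] lies beyond [x], hence strictly to the right
    of the ray from [x] to [p1]. *)
Lemma opening_above n vs q u p1 p2 q' u' x y w : convex_polygon_vertices n vs ->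
  opening vs q u p1 p2 q' u' x y -> polygon_region vs w -> w <> x ->
  0 <= cross (vsub p1 x) (vsub w x) -> 0 < cross u' (vsub w x).
Proof.
  intros C Op Ow Nw Hw. destruct (opening_turn n vs _ _ _ _ _ _ _ _ C Op) as (_ & _ & _ & Y0).
  destruct Op as [_ K' _]. pose proof (dot_self_pos u' (contact_dir _ _ _ _ _ K')) as N.
  pose proof (contact_cross _ _ _ _ _ K' w Ow) as Cw.
  pose proof (contact_ray1 _ _ _ _ _ K') as Yx.
  assert (Ew : cross u' (vsub w x) = cross u' (vsub w q')) 
    by (rewrite cross_vsub in Yx; rewrite !cross_vsub; lra).
  rewrite Ew. destruct Cw as [Cw|Cw]; auto. exfalso.
  symmetry in Cw.
  pose proof (contact_first1 _ _ _ _ _ K' w Ow Cw) as F.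
  assert (Fx : 0 <= dot u' (vsub w x)) by (rewrite !dot_vsub in F; rewrite dot_vsub; lra).
  assert (Id : dot u' u' * cross (vsub p1 x) (vsub w x) =
    dot u' (vsub p1 x) * cross u' (vsub w x) - cross u' (vsub p1 x) * dot u' (vsub w x))
    by (unvec; ring).
  rewrite Ew, Cw in Id.
  apply Nw, (dot_cross_sub_eq u'); [apply K'| |lra].
  nra.
Qed.

(** Seen from [x], the polygon lies in the half-plane bounded by the second [H1], so turning left
    from [p1] to [w] and on to [c] stays within a half-turn. This keeps new second contacts on one
    side of the line [p1 x]. *)
Lemma opening_between n vs q u p1 p2 q' u' x y w c : convex_polygon_vertices n vs ->
  opening vs q u p1 p2 q' u' x y -> polygon_region vs w -> w <> x ->
  0 <= cross (vsub p1 x) (vsub w x) ->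
  polygon_region vs c -> 0 < cross (vsub w x) (vsub c x) ->
  0 <= cross (vsub p1 x) (vsub c x).
Proof.
  intros C Op Ow Nw Hw Oc Hc.
  pose proof (opening_above n vs q u p1 p2 q' u' x y w C Op Ow Nw Hw) as Yw.
  destruct (opening_turn n vs _ _ _ _ _ _ _ _ C Op) as (_ & _ & _ & Y0).
  destruct Op as [_ K' _].
  pose proof (contact_cross _ _ _ _ _ K' c Oc) as Yc.
  pose proof (contact_ray1 _ _ _ _ _ K') as Yx.
  assert (Ec : cross u' (vsub c q') = cross u' (vsub c x) + cross u' (vsub x q')) by (unvec; ring).
  rewrite Yx, Rplus_0_r in Ec. rewrite Ec in Yc.
  assert (Id : cross (vsub p1 x) (vsub c x) * cross u' (vsub w x) =
    cross (vsub p1 x) (vsub w x) * cross u' (vsub c x) +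
    cross (vsub w x) (vsub c x) * cross u' (vsub p1 x)) by (unvec; ring).
  nra.
Qed.

(* [z] is where [H1] touches the polygon when the edge from [w] to [x] gets confirmed; known
   vertices are [p2], [y], or on the other side of the line [p1 x]. *)
Lemma opening_hidden n vs q u p1 p2 q' u' x y w z : convex_polygon_vertices n vs -> obtuse vs ->
  opening vs q u p1 p2 q' u' x y -> In w vs -> w <> x ->
  0 <= cross (vsub p1 x) (vsub w x) ->
  (forall k, In k vs -> cross (vsub w x) (vsub k x) <= 0) ->
  In z vs -> supports vs (vsub w x) z ->
  z <> p2 /\ z <> y /\ cross (vsub p1 x) (vsub z x) < 0.
Proof.
  intros C Ob Op Vw Nw Hw He Vz Sz.
  assert (VO : forall k, In k vs -> polygon_region vs k) by (intros; now apply (vertex_in_region n)).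
  pose proof (opening_above n vs q u p1 p2 q' u' x y w C Op (VO w Vw) Nw Hw) as Yw.
  pose proof (fun H Nz => opening_above n vs q u p1 p2 q' u' x y z C Op (VO z Vz) Nz H) as Yz.
  destruct (opening_turn n vs _ _ _ _ _ _ _ _ C Op) as (A0 & B0 & _ & Y0).
  destruct Op as [K K' _].
  pose proof (dot_self_pos u' (contact_dir _ _ _ _ _ K')) as N.
  pose proof (contact_vertex1 _ _ _ _ _ K) as Vp1.
  pose proof (contact_vertex1 _ _ _ _ _ K') as Vx.
  pose proof (contact_supports1 n vs _ _ _ _ C K x Vx) as Sx. rewrite !dot_perp in Sx.
  pose proof (He p1 Vp1) as Ep.
  assert (Ndw : vsub w x <> origin) by (now apply vsub_neq).
  assert (I1 : forall v, dot u' u' * dot u v = dot u' u * dot u' v - cross u u' * cross u' v)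
    by (intros v; unvec; ring).
  assert (I2 : forall v, dot u' u' * cross u v = cross u u' * dot u' v + dot u' u * cross u' v)
    by (intros v; unvec; ring).
  assert (Sh : cross u (vsub p1 x) <= 0) by (rewrite cross_vsub; lra).
  (* The first [H1] keeps [p1] from being above [x]; [w] comes after [p1] around [x] and inherits
     this. Hence [w - x] makes no acute angle with [u'] or [u], so its extreme vertex is neither [y]
     nor [p2]. *)
  assert (K1 : cross u (vsub w x) <= 0).
  { assert (Id : cross u (vsub w x) * cross u' (vsub p1 x) =
      cross u (vsub p1 x) * cross u' (vsub w x) + cross u u' * cross (vsub w x) (vsub p1 x))
      by (unvec; ring). nra. }
  assert (Xw : dot u' (vsub w x) <= 0).
  { specialize (I2 (vsub w x)). 
    assert (0 <= dot u' u * cross u' (vsub w x)) by (apply Rmult_le_pos; lra). nra. }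
  assert (X0 : dot u' (vsub p1 x) <= 0).
  { specialize (I2 (vsub p1 x)).
    assert (0 <= dot u' u * cross u' (vsub p1 x)) by (apply Rmult_le_pos; lra). nra. }
  repeat split.
  - intros ->. assert (0 < dot u (vsub w x)).
    { apply (supports_acute n vs p2); auto; [apply K|].
      now apply (contact_supports2 n vs q u p1 p2). }
    specialize (I1 (vsub w x)).
    assert (0 <= cross u u' * cross u' (vsub w x)) by (apply Rmult_le_pos; lra). nra.
  - intros ->. assert (0 < dot u' (vsub w x)); [|lra].
    apply (supports_acute n vs y); auto; [apply K'|].
    now apply (contact_supports2 n vs q' u' x y).
  - destruct (Rlt_le_dec (cross (vsub p1 x) (vsub z x)) 0) as [L|L]; auto. exfalso.
    (* At [z = x] the edge direction and the inner normal of that edge would be orthogonal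
       supports. *)
    destruct (classic (z = x)) as [->|Nz].
    { set (m := vscale (-1) (perp (vsub w x))).
      assert (Em : forall v, dot m v = - cross (vsub w x) v) by (intros; unfold m; unvec; ring).
      assert (Pm : 0 < dot m (vsub w x));
        [|rewrite Em in Pm; clear - Pm; unvec; lra].
      apply (supports_acute n vs x); auto.
      - intros E. apply (perp_neq _ Ndw). subst m. unfold vscale in E.
        injection E; intros E2 E1.
        apply point_eq; change (fst origin) with 0; change (snd origin) with 0; unvec; lra.
      - intros k Hk. rewrite !Em. specialize (He k Hk). rewrite cross_vsub in He. lra. }
    specialize (Yz L Nz). specialize (Sz x Vx).
    pose proof (He z Vz) as Ez.
    set (dw := vsub w x) in *. set (dz := vsub z x) in *. set (d0 := vsub p1 x) in *.
    assert (Dz : dot dw dz <= 0) by (unfold dz; rewrite dot_vsub; lra).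
    (* Both [d0] and [dw] lie in one quadrant of the frame of [u']. A [z] left of [d0], right of
       [dw] and behind [x] along [dw] must lie on the line of [dw] behind [x], which is not above
       the second [H1]. *)
    assert (P : 0 < dot d0 dw).
    { assert (Id : dot u' u' * dot d0 dw = dot u' d0 * dot u' dw + cross u' d0 * cross u' dw)
        by (unvec; ring). nra. }
    assert (D : 0 < dot dw dw) by (apply dot_self_pos; auto).
    assert (Id : dot dw dw * cross d0 dz = dot d0 dw * cross dw dz + cross d0 dw * dot dw dz)
      by (unvec; ring).
    assert (Id' : dot dw dw * cross u' dz = cross u' dw * dot dw dz + dot u' dw * cross dw dz)
      by (unvec; ring).
    assert (Z : cross dw dz = 0) by nra.
    rewrite Z in Id'. nra.
Qed.

(** * The strategy *)

Definition contacts (r : response) : list point :=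
  match r with Miss => [] | Hit _ _ c1 c2 => [c1; c2] end.

Definition known (h : history) : list point := flat_map (fun e => contacts (snd e)) h.

(* The edge ending at [b] has been seen: a line issued from [b] was answered by a wedge whose
   second contact is [b] itself.  The first line is excluded, since its base point is arbitrary. *)
Definition confirmed (h : history) (b : point) : Prop :=
  exists d q u c1, In ((b, d), Hit q u c1 b) (tl h).

Definition contact1 (r : response) : point :=
  match r with Miss => origin | Hit _ _ c1 _ => c1 end.

(** After one probe this is [p1], which fixes the second line as the one from [p1] to [p2]; from
    then on it is [x]. The value [origin] is a mere default: [next_line] is consulted only on
    nonempty histories, and valid probes always hit here. *)
Definition focus (h : history) : point :=
  match h with
  | [] => origin
  | [e] => contact1 (snd e)
  | _ :: e :: _ => contact1 (snd e)
  end.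

Definition target (h : history) (b : point) : Prop :=
  In b (known h) /\ ~ confirmed h b /\ (~ confirmed h (focus h) -> b = focus h).

(* [w] is the known vertex preceding [b] in counterclockwise order. *)
Definition precedes (h : history) (w b : point) : Prop :=
  In w (known h) /\ w <> b /\
  forall k, In k (known h) -> cross (vsub w b) (vsub k b) <= 0.

Definition next_line (h : history) (L : line) : Prop :=
  exists b w, target h b /\ precedes h w b /\ L = (b, vsub w b).

Definition chord_strategy : strategy := fun p c rho h =>
  match h with
  | [] => Probe (p, (1, 0))
  | _ =>
      if excluded_middle_informative (exists L, next_line h L)
      then Probe (epsilon (inhabits (origin, origin)) (next_line h))
      else Answer (known h)
  end.

Lemma chord_strategy_cases p c rho h : h <> [] ->
  (exists L, next_line h L /\ chord_strategy p c rho h = Probe L) \/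
  ((forall L, ~ next_line h L) /\ chord_strategy p c rho h = Answer (known h)).
Proof.
  intros Hh. destruct h as [|e h]; [easy|]. unfold chord_strategy.
  destruct excluded_middle_informative as [E|E].
  - left. eexists; split; [|reflexivity]. now apply epsilon_spec.
  - right. split; auto. intros L HL. apply E. now exists L.
Qed.

(** * Invariants of the history and counting *)

Lemma known_app h1 h2 : known (h1 ++ h2) = known h1 ++ known h2.
Proof. apply flat_map_app. Qed.

Lemma tl_app {A : Type} (l l' : list A) : l <> [] -> tl (l ++ l') = tl l ++ l'.
Proof. destruct l; easy. Qed.

Lemma confirmed_app h L q u c1 c2 b : h <> [] ->
  confirmed (h ++ [(L, Hit q u c1 c2)]) b <-> confirmed h b \/ (fst L = b /\ c2 = b).
Proof.
  intros Nh. unfold confirmed. rewrite tl_app by assumption. split.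
  - intros (d & q0 & u0 & c & H). apply in_app_or in H. destruct H as [H|[H|[]]].
    + left; eauto.
    + right. now inversion H.
  - intros [(d & q0 & u0 & c & H)|[E1 ->]].
    + exists d, q0, u0, c. apply in_or_app. now left.
    + exists (snd L), q, u, c1. apply in_or_app. right. left. destruct L; cbn in *; subst; auto.
Qed.

(** The field [consistent_two] provides every target with a known predecessor;
    [consistent_confirmed] makes a confirmed [w b] an edge of the polygon, not just of the known
    part. *)
Record consistent (vs : list point) (h : history) : Prop := {
  consistent_nonempty : h <> [];
  consistent_known : incl (known h) vs;
  consistent_focus : In (focus h) (known h);
  consistent_two : forall b, exists k, In k (known h) /\ k <> b;
  consistent_confirmed : forall b, confirmed h b -> In b (known h) /\
    exists w, In w (known h) /\ w <> b /\
      forall k, In k vs -> cross (vsub w b) (vsub k b) <= 0 }.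

Lemma no_next_confirmed n vs h : convex_polygon_vertices n vs -> consistent vs h ->
  (forall L, ~ next_line h L) -> forall b, In b (known h) -> confirmed h b.
Proof.
  intros C Hh NL b Hb. destruct (classic (confirmed h b)) as [Y|N]; auto. exfalso.
  assert (T : exists t, target h t).
  { destruct (classic (confirmed h (focus h))) as [Y'|N'].
    - exists b. repeat split; auto. easy.
    - exists (focus h). repeat split; auto. apply Hh. }
  destruct T as [t T].
  destruct (last_around n vs (known h) t C (consistent_known _ _ Hh)) as [w Hw].
  - apply Hh, T.
  - apply Hh.
  - apply (NL (t, vsub w t)). now exists t, w.
Qed.

Lemma confirmed_complete n vs h : convex_polygon_vertices n vs -> consistent vs h ->
  (forall b, In b (known h) -> confirmed h b) -> forall x, In x (known h) <-> In x vs.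
Proof.
  intros C Hh H x. split; [apply Hh|]. revert x.
  apply (predecessor_closed n); auto; try apply Hh.
  - intros E. destruct (consistent_two _ _ Hh origin) as [k [Hk _]]. now rewrite E in Hk.
  - intros b Hb. now apply Hh, H.
Qed.

(** Repetition-free lists witness a lower bound for vertices seen plus edges confirmed, an edge
    being named by its end; [known h] itself may contain repetitions. *)
Definition counted (h : history) (N : nat) : Prop :=
  exists Kl El, NoDup Kl /\ NoDup El /\ incl Kl (known h) /\
    (forall b, In b El -> confirmed h b) /\ (N <= length Kl + length El)%nat.

(** A second contact [b] confirms an edge that was unconfirmed. Any other one is strictly left of
    [b w], where no known vertex lies. *)
Lemma counted_gain n vs h N b w q u c1 c2 : convex_polygon_vertices n vs -> obtuse vs ->
  consistent vs h -> target h b -> precedes h w b ->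
  contact vs q u c1 c2 -> chord q u b w -> counted h N ->
  let h' := h ++ [((b, vsub w b), Hit q u c1 c2)] in
  counted h' (S N) /\ (~ In c1 (known h) -> counted h' (S (S N))).
Proof.
  intros C Ob Hh (Kb & Nb & _) (Kw & Nw & Hw) K Ch (Kl & El & DK & DE & IK & IE & HN) h'.
  pose proof (consistent_nonempty _ _ Hh) as Nh.
  assert (EK : known h' = known h ++ [c1; c2]) by apply known_app.
  assert (IK' : incl Kl (known h')) by (rewrite EK; now apply incl_appl).
  assert (IE' : forall e, In e El -> confirmed h' e).
  { intros e He. apply confirmed_app; auto. }
  assert (K1 : In c1 (known h')) by (rewrite EK; apply in_or_app; right; now left).
  assert (K2 : In c2 (known h')) by (rewrite EK; apply in_or_app; right; right; now left).
  destruct (classic (c2 = b)) as [->|N2].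
  - assert (DE' : NoDup (b :: El)) by (constructor; auto).
    assert (IE2 : forall e, In e (b :: El) -> confirmed h' e).
    { intros e [<-|He]; auto. apply confirmed_app; auto. }
    split.
    + exists Kl, (b :: El). repeat split; auto. cbn [length]; lia.
    + intros N1. exists (c1 :: Kl), (b :: El). repeat split; auto.
      * constructor; auto.
      * now apply incl_cons.
      * cbn [length]; lia.
  - assert (P : 0 < cross (vsub w b) (vsub c2 b)).
    { apply (chord_discovers n vs q u c1); auto; now apply Hh. }
    assert (New : ~ In c2 (known h)) by (intros I; specialize (Hw c2 I); lra).
    assert (D2 : NoDup (c2 :: Kl)) by (constructor; auto).
    assert (I2 : incl (c2 :: Kl) (known h')) by now apply incl_cons.
    split.
    + exists (c2 :: Kl), El. repeat split; auto. cbn [length]; lia.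
    + intros N1. exists (c1 :: c2 :: Kl), El. repeat split; auto.
      * constructor; auto. intros [E|E]; [|auto].
        now apply (contact_distinct n vs q u c1 c2 C Ob K).
      * now apply incl_cons.
      * cbn [length]; lia.
Qed.

Lemma probe_step n vs h L : convex_polygon_vertices n vs -> obtuse vs ->
  consistent vs h -> next_line h L ->
  proper_line L /\
  forall r, valid_response (PI / 2) (polygon_region vs) L r ->
    exists b w q u c1 c2, L = (b, vsub w b) /\ r = Hit q u c1 c2 /\
      target h b /\ precedes h w b /\ contact vs q u c1 c2 /\ chord q u b w /\
      consistent vs (h ++ [(L, r)]).
Proof.
  intros C Ob Hh (b & w & T & P & ->).
  pose proof T as (Kb & Nb & _). pose proof P as (Kw & Nw & Hw).
  pose proof (consistent_known _ _ Hh _ Kb) as Vb.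
  pose proof (vertex_in_region n vs b C Vb) as Rb.
  pose proof (consistent_nonempty _ _ Hh) as Nh.
  pose proof (vsub_neq _ _ Nw) as Nd. split; [exact Nd|].
  intros [|q u c1 c2] Hr.
  { exfalso. apply Hr. now apply (valid_probe_exists n). }
  destruct (response_contact n vs _ _ _ _ _ C Ob Hr) as (K & OL & Far).
  pose proof (chord_probe vs q u c1 c2 b w K Rb Nw OL Far) as Ch.
  exists b, w, q, u, c1, c2. do 2 (split; [reflexivity|]). do 4 (split; [assumption|]).
  constructor.
  - intros E. now apply app_eq_nil in E.
  - rewrite known_app. apply incl_app; [apply Hh|].
    intros k [<-|[<-|[]]]; apply K.
  - rewrite known_app. apply in_or_app.
    (* The focus changes only at the second probe, to its first contact. *)
    destruct h as [|e [|e' h]]; [easy| |].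
    + right. now left.
    + left. apply Hh.
  - intros a. destruct (consistent_two _ _ Hh a) as (k & Hk & Nk). exists k. split; auto.
    rewrite known_app. apply in_or_app. now left.
  - intros a Ha. apply confirmed_app in Ha; auto. rewrite known_app. cbn [fst] in Ha.
    destruct Ha as [Ha|[<- ->]].
    + destruct (consistent_confirmed _ _ Hh _ Ha) as (Ka & v & Hv & R).
      split; [apply in_or_app; now left|]. exists v. split; auto. apply in_or_app. now left.
    + split; [apply in_or_app; now left|].
      exists w. split; [apply in_or_app; now left|]. split; auto.
      now apply (chord_confirms n vs q u c1).
Qed.

Lemma counted_bound vs h Kl El : consistent vs h ->
  NoDup Kl -> NoDup El -> incl Kl (known h) -> (forall b, In b El -> confirmed h b) ->
  (length Kl <= length vs)%nat /\ (length El <= length vs)%nat /\ incl El vs.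
Proof.
  intros Hh DK DE IK IE.
  assert (I : incl El vs) by (intros b Hb; now apply Hh, Hh, IE).
  repeat split; auto; apply NoDup_incl_length; auto.
  apply (incl_tran IK), Hh.
Qed.

(** The count stays three ahead of the probes made. When none is left it has reached [2 * n], so
    every edge is confirmed and no target remains. *)
Lemma succeeds_surplus n vs p c rho : convex_polygon_vertices n vs -> obtuse vs ->
  forall k h, (length h + k + 3 = 2 * n)%nat -> consistent vs h ->
  counted h (length h + 3) ->
  succeeds (PI / 2) (polygon_region vs) vs (chord_strategy p c rho) k h.
Proof.
  intros C Ob. pose proof C as (Hn & Hl & _). induction k as [|k IH]; intros h Hk Hh Hc;
    destruct (chord_strategy_cases p c rho h (consistent_nonempty _ _ Hh))
      as [(L & HL & E)|(NL & E)]; cbn [succeeds]; rewrite E;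
    try (apply (confirmed_complete n); auto; now apply (no_next_confirmed n vs)).
  - destruct Hc as (Kl & El & DK & DE & IK & IE & HN).
    destruct (counted_bound vs h Kl El Hh DK DE IK IE) as (B1 & B2 & B3).
    destruct HL as (b & w & (Kb & Nb & _) & _). apply Nb, IE.
    apply (NoDup_length_incl (l' := vs) DE); [lia|auto|now apply Hh].
  - destruct (probe_step n vs h L C Ob Hh HL) as (PL & HP). split; auto.
    intros r Hr. destruct (HP r Hr) as (b & w & q & u & c1 & c2 & -> & -> & T & P & K & Ch & Hh').
    apply IH; auto.
    + rewrite length_app. cbn [length]. lia.
    + rewrite length_app. cbn [length].
      replace (length h + 1 + 3)%nat with (S (length h + 3)) by lia.
      now apply (counted_gain n vs).
Qed.

(** The phase with a surplus of two, while the edge ending at [x] is open. The last clause lists the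
    places that [opening_hidden] excludes for [z]. *)
Definition opening_state (vs : list point) (h : history) : Prop :=
  exists q u p1 p2 q' u' x y, opening vs q u p1 p2 q' u' x y /\
    (2 <= length h)%nat /\ focus h = x /\ ~ confirmed h x /\ In p1 (known h) /\
    forall k, In k (known h) -> k = p2 \/ k = y \/ 0 <= cross (vsub p1 x) (vsub k x).

Lemma opening_distinct n vs q u p1 p2 q' u' x y : convex_polygon_vertices n vs ->
  opening vs q u p1 p2 q' u' x y -> p1 <> x.
Proof.
  intros C Op ->. destruct (opening_turn n vs _ _ _ _ _ _ _ _ C Op) as (_ & _ & _ & H).
  unvec; lra.
Qed.

Lemma opening_state_incomplete n vs h : convex_polygon_vertices n vs -> obtuse vs ->
  opening_state vs h -> exists z, In z vs /\ ~ In z (known h).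
Proof.
  intros C Ob (q & u & p1 & p2 & q' & u' & x & y & Op & _ & _ & _ & _ & HK).
  pose proof (opening_distinct n vs _ _ _ _ _ _ _ _ C Op) as N1.
  pose proof (contact_vertex1 _ _ _ _ _ (opening_first _ _ _ _ _ _ _ _ _ Op)) as V1.
  pose proof (contact_vertex1 _ _ _ _ _ (opening_second _ _ _ _ _ _ _ _ _ Op)) as Vx.
  destruct (last_around n vs vs x C (incl_refl vs) Vx) as (w & Vw & Nw & Hw).
  { now exists p1. }
  (* [w] is the true predecessor of [x]; the functional [origin] leaves ties open. *)
  destruct (region_lex_min n vs (vsub w x) origin C) as (z & Vz & Hz).
  exists z. split; auto. intros Kz.
  destruct (opening_hidden n vs q u p1 p2 q' u' x y w z) as (Z1 & Z2 & Z3); auto.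
  - specialize (Hw p1 V1). unvec; lra.
  - intros k Hk. destruct (Hz k (vertex_in_region n vs k C Hk)); lra.
  - destruct (HK z Kz) as [->|[->|G]]; [auto|auto|lra].
Qed.

Lemma succeeds_opening n vs p c rho : convex_polygon_vertices n vs -> obtuse vs ->
  forall k h, (length h + k + 3 = 2 * n)%nat -> consistent vs h ->
  opening_state vs h -> counted h (length h + 2) ->
  succeeds (PI / 2) (polygon_region vs) vs (chord_strategy p c rho) k h.
Proof.
  intros C Ob. pose proof C as (Hn & Hl & _). induction k as [|k IH]; intros h Hk Hh Ho Hc;
    destruct (chord_strategy_cases p c rho h (consistent_nonempty _ _ Hh))
      as [(L & HL & E)|(NL & E)]; cbn [succeeds]; rewrite E;
    try (apply (confirmed_complete n); auto; now apply (no_next_confirmed n vs)).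
  - destruct (opening_state_incomplete n vs h C Ob Ho) as (z & Vz & Nz).
    destruct Ho as (q & u & p1 & p2 & q' & u' & x & y & Op & _ & _ & Nx & _).
    destruct Hc as (Kl & El & DK & DE & IK & IE & HN).
    destruct (counted_bound vs h Kl El Hh DK DE IK IE) as (B1 & B2 & B3).
    assert (L1 : (length (z :: Kl) <= length vs)%nat).
    { apply NoDup_incl_length; [constructor; auto|]. apply incl_cons; auto.
      apply (incl_tran IK), Hh. }
    assert (L2 : (length (x :: El) <= length vs)%nat).
    { apply NoDup_incl_length; [constructor; auto|]. apply incl_cons; auto. apply Op. }
    cbn [length] in *. lia.
  - destruct (probe_step n vs h L C Ob Hh HL) as (PL & HP). split; auto.
    intros r Hr. destruct (HP r Hr) as (b & w & q0 & u0 & c1 & c2 & -> & -> & T & P & K & Ch & Hh').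
    pose proof (consistent_nonempty _ _ Hh) as Nh.
    destruct (counted_gain n vs h _ b w q0 u0 c1 c2 C Ob Hh T P K Ch Hc) as [G1 G2].
    destruct Ho as (q & u & p1 & p2 & q' & u' & x & y & Op & L2 & Fx & Nx & K1 & HK).
    assert (b = x) as -> by (destruct T as (_ & _ & T); rewrite Fx in T; now apply T).
    pose proof (vertex_in_region n vs) as VR.
    destruct P as (Kw & Nw & Hw). pose proof (consistent_known _ _ Hh _ Kw) as Vw.
    assert (Rw : 0 <= cross (vsub p1 x) (vsub w x)) by (specialize (Hw p1 K1); unvec; lra).
    assert (Sur : ~ In c1 (known h) -> succeeds (PI / 2) (polygon_region vs) vs
      (chord_strategy p c rho) k (h ++ [((x, vsub w x), Hit q0 u0 c1 c2)])).
    { intros N1. apply (succeeds_surplus n); auto.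
      - rewrite length_app. cbn [length]. lia.
      - rewrite length_app. cbn [length].
        replace (length h + 1 + 3)%nat with (S (S (length h + 2))) by lia. auto. }
    (* A new first contact wins the third extra unit at once. Otherwise the probe either closes the
       edge at [x], where [c1] cannot be known after all, or adds [c2] and prolongs the phase. *)
    destruct (classic (In c1 (known h))) as [Y1|N1]; [|auto].
    destruct (classic (c2 = x)) as [->|N2].
    + apply Sur. intros _.
      destruct (chord_confirms n vs q0 u0 c1 w x C K Ch) as (Z & He).
      destruct (opening_hidden n vs q u p1 p2 q' u' x y w c1) as (Z1 & Z2 & Z3); auto.
      * apply K.
      * intros v Hv. pose proof (contact_supports1 n vs _ _ _ _ C K v Hv) as S.
        rewrite !dot_perp in S. destruct Ch as (_ & _ & Pc & _).
        pose proof (dot_self_pos u0 (contact_dir _ _ _ _ _ K)) as N.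
        assert (Id : forall t, dot u0 u0 * dot (vsub w x) t =
          dot u0 (vsub w x) * dot u0 t + cross u0 (vsub w x) * cross u0 t)
          by (intros; unvec; ring).
        pose proof (Id c1) as I1. pose proof (Id v) as I2. rewrite Z in I1, I2. nra.
      * destruct (HK c1 Y1) as [->|[->|G]]; [auto|auto|lra].
    + apply IH; auto.
      * rewrite length_app. cbn [length]. lia.
      * exists q, u, p1, p2, q', u', x, y. split; auto. repeat split.
        -- rewrite length_app. lia.
        -- rewrite <- Fx. destruct h as [|e [|e' h]]; cbn in L2; [lia|lia|reflexivity].
        -- intros Hx. apply confirmed_app in Hx; auto. destruct Hx as [Hx|[_ Hx]]; auto.
        -- rewrite known_app. apply in_or_app. now left.
        -- intros v Hv. rewrite known_app in Hv. apply in_app_or in Hv.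
           destruct Hv as [Hv|[<-|[<-|[]]]]; auto.
           right; right. apply (opening_between n vs q u p1 p2 q' u' x y w); auto.
           ++ apply VR; auto. apply K.
           ++ apply (chord_discovers n vs q0 u0 c1); auto. apply Op.
      * rewrite length_app. cbn [length].
        replace (length h + 1 + 2)%nat with (S (length h + 2)) by lia. auto.
Qed.

Theorem theorem4p4 :
  exists S : strategy,
    forall (n : nat) (vs : list point),
      convex_polygon_vertices n vs ->
      (forall i : nat, (i < n)%nat -> internal_angle vs i > PI / 2) ->
      forall (p c : point) (rho : R),
        polygon_region vs p ->
        0 < rho ->
        (forall x, polygon_region vs x -> pdist x c <= rho) ->
        succeeds (PI / 2) (polygon_region vs) vs (S p c rho) (2 * n - 3)%nat nil.
Proof.
  exists chord_strategy. intros n vs C Ob' p c rho Hp _ _.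
  pose proof C as (Hn & Hl & _).
  assert (Ob : obtuse vs) by (unfold obtuse; now rewrite Hl).
  (* [n >= 3] leaves room for the two opening probes. *)
  destruct (2 * n - 3)%nat as [|[|k]] eqn:Ek; [lia|lia|].
  assert (Nd : (1, 0) <> origin) by (intros E; injection E; lra).
  cbn [succeeds]. unfold chord_strategy at 1. split; [exact Nd|].
  intros [|q u p1 p2] Hr.
  { exfalso. apply Hr. now apply (valid_probe_exists n). }
  destruct (response_contact n vs _ _ _ _ _ C Ob Hr) as (K & _ & _).
  pose proof (contact_distinct n vs q u p1 p2 C Ob K) as N12.
  cbn [app]. set (h := [((p, (1, 0)), Hit q u p1 p2)]).
  assert (NC : forall b, ~ confirmed h b) by (intros b (? & ? & ? & ? & [])).
  assert (Hh : consistent vs h).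
  { constructor.
    - easy.
    - intros k0 [<-|[<-|[]]]; apply K.
    - now left.
    - intros b. destruct (classic (p1 = b)) as [<-|N].
      + exists p2. split; [now right; left|auto].
      + exists p1. split; [now left|auto].
    - intros b Hb. now apply NC in Hb. }
  assert (Hc : counted h 2).
  { exists [p1; p2], []. repeat split; auto.
    - repeat constructor; intros H; cbn in H; intuition congruence.
    - constructor.
    - apply incl_refl.
    - now intros b []. }
  change (succeeds (PI / 2) (polygon_region vs) vs (chord_strategy p c rho) (S k) h).
  destruct (chord_strategy_cases p c rho h (consistent_nonempty _ _ Hh))
      as [(L & HL & E)|(NL & E)]; cbn [succeeds]; rewrite E;
    try (apply (confirmed_complete n); auto; now apply (no_next_confirmed n vs)).
  destruct (probe_step n vs h L C Ob Hh HL) as (PL & HP). split; auto.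
  intros r Hr'.
  destruct (HP r Hr') as (b & w & q' & u' & x & y & -> & -> & T & P & K' & Ch & Hh').
  destruct (counted_gain n vs h _ b w q' u' x y C Ob Hh T P K' Ch Hc) as [_ G].
  assert (b = p1) as -> by (now apply T).
  assert (w = p2) as ->.
  { destruct P as ([<-|[<-|[]]] & Nw & _); easy. }
  assert (Op : opening vs q u p1 p2 q' u' x y) by now constructor.
  destruct (opening_turn n vs _ _ _ _ _ _ _ _ C Op) as (_ & _ & Pd & _).
  (* Only [p1] and [p2] are known so far, both on the probing line, and [x] is strictly to its
     right. So [x] is new, and the count is four after two probes. *)
  pose proof (second_right n vs q' u' x y p2 p1 C K' Ch Pd) as Rx.
  assert (Nx : ~ In x (known h)).
  { intros [<-|[<-|[]]]; unvec; lra. }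
  apply (succeeds_opening n); auto.
  - cbn [length h app]. lia.
  - exists q, u, p1, p2, q', u', x, y. split; auto. repeat split.
    + cbn; lia.
    + intros Hx. apply confirmed_app in Hx; [|easy]. destruct Hx as [Hx|[Hx _]].
      * now apply NC in Hx.
      * cbn in Hx. subst. apply Nx. now left.
    + now left.
    + intros k0 [<-|[<-|[<-|[<-|[]]]]]; auto; right; right; unvec; lra.
Qed.
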